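(* Let $\kappa$ be an infinite cardinal, let $X$ be a Lindenstrauss space, and let $0\to c_0(\kappa)\to Z\to X\to 0$ be an exact sequence of Banach spaces. Then $Z$ is isomorphic to a Lindenstrauss space.
   Context: An exact sequence of Banach spaces is a diagram $0\to Y\to Z\to X\to 0$ of Banach spaces and bounded linear operators in which the kernel of each operator equals the image of the preceding one; $Z$ is called a twisted sum of $Y$ and $X$. A Lindenstrauss space is a Banach space whose dual is isometrically isomorphic to $L_1(\mu)$ for some measure $\mu$. ''Isomorphic'' means linearly homeomorphic. *)

(* Defs.v *)
From HB Require Import structures.
From mathcomp Require Import all_boot all_order all_algebra generic_quotient.
From mathcomp Require Import all_classical all_reals all_analysis.
(* Needed for the measurable structure on [\bar R]. *)
From mathcomp Require Import measurable_realfun.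
Import Order.TTheory GRing.Theory Num.Theory.
Import numFieldNormedType.Exports.

Set Implicit Arguments.
Unset Strict Implicit.
Unset Printing Implicit Defensive.

Local Open Scope classical_set_scope.
Local Open Scope ring_scope.

Section supnorm.
Context {R : realType} {I : Type} (A : set I).
Implicit Types f g : I -> R^o.

Definition supnorm f : R := sup [set `|f i| | i in A].

Definition supbounded f := has_ubound [set `|f i| | i in A].

Lemma supnorm_ub f i : supbounded f -> A i -> `|f i| <= supnorm f.
Proof. by move=> bf Ai; apply: ub_le_sup => //; exists i. Qed.

Lemma supnorm_le f M : 0 <= M -> (forall i, A i -> `|f i| <= M) ->
  supnorm f <= M.
Proof.
move=> M0 fM; have [A0|/set0P[i Ai]] := eqVneq A set0.
  by rewrite /supnorm A0 image_set0 sup0.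
apply: ge_sup => [|_ [k Ak <-]]; last exact: fM.
by exists `|f i|; exists i.
Qed.

Lemma supnorm_ge0 f : supbounded f -> 0 <= supnorm f.
Proof.
move=> bf; have [A0|/set0P[i Ai]] := eqVneq A set0.
  by rewrite /supnorm A0 image_set0 sup0.
exact: le_trans (supnorm_ub bf Ai).
Qed.

Lemma supnormD f g : supbounded f -> supbounded g ->
  supnorm (f + g) <= supnorm f + supnorm g.
Proof.
move=> bf bg; apply: supnorm_le => [|i Ai].
  by rewrite addr_ge0// supnorm_ge0.
by rewrite (le_trans (ler_normD _ _))// lerD// supnorm_ub.
Qed.

Lemma supboundedZ a f : supbounded f -> supbounded (a *: f).
Proof.
move=> [M fM]; exists (`|a| * M) => _ [i Ai <-].
rewrite [(a *: f) i]/(a * f i) normrM ler_wpM2l//.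
by apply: fM; exists i.
Qed.

Let supnormZ_le a f : supbounded f -> supnorm (a *: f) <= `|a| * supnorm f.
Proof.
move=> bf; apply: supnorm_le => [|i Ai].
  by rewrite mulr_ge0// supnorm_ge0.
by rewrite [(a *: f) i]/(a * f i) normrM ler_wpM2l// supnorm_ub.
Qed.

Lemma supnormZ a f : supbounded f -> supnorm (a *: f) = `|a| * supnorm f.
Proof.
move=> bf; apply/eqP; rewrite eq_le supnormZ_le//=.
have [->|a0] := eqVneq a 0.
  by rewrite normr0 mul0r supnorm_ge0//; exact: supboundedZ.
rewrite -ler_pdivlMl ?normr_gt0// -normfV.
have {1}-> : f = a^-1 *: (a *: f) by rewrite scalerA mulVf// scale1r.
by apply: supnormZ_le; exact: supboundedZ.
Qed.

End supnorm.

Section c0.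
Context (R : realType) (I : Type).

Definition vanishing : {pred I -> R^o} :=
  mem [set f | forall e : R, 0 < e -> finite_set [set i | e <= `|f i|]].

Lemma vanishing_submod_closed : submod_closed vanishing.
Proof.
split.
  rewrite inE => e e0; apply: (sub_finite_set _ (finite_set0 I)) => i /=.
  by rewrite [X in `|X|]/(0 : R) normr0 leNgt e0.
move=> a f g /[!inE] /= f0 g0 e e0.
pose d := e / 2 / (`|a| + 1).
have a1 : 0 < `|a| + 1 by rewrite ltr_wpDl.
have e2 : 0 < e / 2 by rewrite divr_gt0.
have d0 : 0 < d by rewrite divr_gt0.
apply: (@sub_finite_set _ _
    ([set i | d <= `|f i|] `|` [set i | e / 2 <= `|g i|])); last first.
  by rewrite finite_setU; split; [exact: f0|exact: g0].
move=> i /= eafg; apply/orP; apply: contraLR eafg.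
rewrite negb_or -!ltNge => /andP[fd ge].
rewrite [X in `|X|]/(a * f i + g i).
rewrite (le_lt_trans (ler_normD _ _))// (splitr e).
apply: ler_ltD => //; rewrite normrM.
rewrite (@le_trans _ _ ((`|a| + 1) * `|f i|))//.
  by rewrite ler_wpM2r// lerDl.
by rewrite mulrC -ler_pdivlMr// ltW.
Qed.

HB.instance Definition _ :=
  GRing.isSubmodClosed.Build R (I -> R^o) vanishing vanishing_submod_closed.

Record c0 := C0 { c0_fun :> I -> R^o ; c0_vanishing : c0_fun \in vanishing }.

HB.instance Definition _ := [isSub for c0_fun].
HB.instance Definition _ := [Choice of c0 by <:].
HB.instance Definition _ := [SubChoice_isSubLmodule of c0 by <:].

Lemma c0_supbounded (f : c0) : supbounded setT f.
Proof.
case: f => f /=; rewrite inE => /(_ 1 ltr01) /= fin1.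
have [M [_ fM]] : bounded_set ((fun i => `|f i|) @` [set i | 1 <= `|f i|]).
  by apply: compact_bounded; apply: finite_compact; exact: finite_image.
exists (Num.max 1 (M + 1)) => _ [i _ <-]; rewrite le_max.
have [//|fi1] := leP `|f i| 1.
apply: le_trans (ler_norm _) _.
by apply: fM; [rewrite ltrDl|exists i => //; exact: ltW].
Qed.

Definition c0_norm (f : c0) : R := supnorm setT f.

Let c0_normD f g : c0_norm (f + g) <= c0_norm f + c0_norm g.
Proof. exact: supnormD (c0_supbounded f) (c0_supbounded g). Qed.

Let c0_normZ a f : c0_norm (a *: f) = `|a| * c0_norm f.
Proof. exact: supnormZ (c0_supbounded f). Qed.

Let c0_norm_eq0 f : c0_norm f = 0 -> f = 0.
Proof.
move=> f0; apply: val_inj; apply/funext => i.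
rewrite [RHS]/(0 : R); apply/eqP; rewrite -normr_le0 -f0.
exact: (supnorm_ub (c0_supbounded f)).
Qed.

HB.instance Definition _ :=
  Lmodule_isNormed.Build R c0 c0_normD c0_normZ c0_norm_eq0.

Lemma c0_normE (f : c0) : `|f| = sup [set `|f i| | i in [set: I]].
Proof. by []. Qed.

Lemma c0_le_norm (f : c0) i : `|f i| <= `|f|.
Proof. exact: (supnorm_ub (c0_supbounded f)). Qed.

Lemma c0_complete (F : set_system c0) : ProperFilter F -> cauchy F -> cvg F.
Proof.
move=> FF /cauchy_ballP Fc.
have Fc_norm e : 0 < e -> \forall f & g \near F, `|f - g| <= e.
  move=> e0; have := Fc e e0; rewrite -ball_normE.
  by apply: filterS => -[f g] /= /ltW.
have Fi_cvg i : cvg ((fun f : c0 => f i : R) @ F).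
  apply: cauchy_cvg; apply: cauchy_exP => e e0.
  have e2 : 0 < e / 2 by rewrite divr_gt0.
  near F => f; exists (f i); rewrite -ball_normE.
  suff : \forall g \near F, `|f - g| <= e / 2.
    apply: filterS => g /= fg.
    apply: le_lt_trans (c0_le_norm (f - g) i) _; apply: le_lt_trans fg _.
    by rewrite ltr_pdivrMr// ltr_pMr// ltr1n.
  by near: f; apply: nearP_dep; exact: Fc_norm.
pose l : I -> R^o := fun i => lim ((fun f : c0 => f i : R) @ F).
have Fl e : 0 < e -> \forall f \near F, forall i, `|(f : c0) i - l i| <= e.
  move=> e0; have e2 : 0 < e / 2 by rewrite divr_gt0.
  near=> f => i; near F => g.
  rewrite (splitr e) (le_trans (ler_distD (g i : R) _ _))// lerD//.
    apply: le_trans (c0_le_norm (f - g) i) _.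
    by near: g; near: f; apply: nearP_dep; exact: Fc_norm.
  rewrite distrC; near: g.
  by have /cvgrPdist_le := Fi_cvg i; exact.
have l0 : l \in vanishing.
  rewrite inE => e e0; have e2 : 0 < e / 2 by rewrite divr_gt0.
  near F => f.
  have := c0_vanishing f; rewrite inE => /(_ _ e2); apply: sub_finite_set.
  move=> i /= ei; rewrite -(lerD2r (e / 2)) -splitr (le_trans ei)//.
  rewrite -lerBlDl; apply: le_trans (lerB_dist _ _) _; rewrite distrC.
  by move: (i); near: f; exact: Fl.
apply/cvg_ex; exists (C0 l0); apply/cvgrPdist_le => e e0; near=> f.
apply: supnorm_le => [|i _]; first exact: ltW.
rewrite [X in `|X|]/(l i - f i) distrC.
by move: (i); near: f; exact: Fl.
Unshelve. all: by end_near. Qed.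

HB.instance Definition _ := Uniform_isComplete.Build c0 c0_complete.

End c0.

Section dual_space.
Context (R : realType) (X : normedModType R).

Definition functional : {pred X -> R^o} :=
  mem [set f | linear f /\ continuous f].

Lemma functional_submod_closed : submod_closed functional.
Proof.
split.
  rewrite inE; split; last exact: cst_continuous.
  by move=> a x y; rewrite scaler0 addr0.
move=> a f g /[!inE] /= -[lf cf] [lg cg]; split.
  move=> b x y; rewrite ![(a *: f + g) _]/(a *: f _ + g _) lf lg.
  by rewrite !scalerDr !scalerA mulrC addrACA.
move=> x; apply: (@continuousD _ _ _ (fun x => a *: f x) g); last exact: cg.
by apply: continuousZr; exact: cf.
Qed.

HB.instance Definition _ :=
  GRing.isSubmodClosed.Build R (X -> R^o) functional functional_submod_closed.

Record dual_space :=
  Dual { dual_fun :> X -> R^o ; dual_functional : dual_fun \in functional }.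

HB.instance Definition _ := [isSub for dual_fun].
HB.instance Definition _ := [Choice of dual_space by <:].
HB.instance Definition _ := [SubChoice_isSubLmodule of dual_space by <:].

Lemma dual_linear (f : dual_space) : linear f.
Proof. by case: f => f /=; rewrite inE => -[]. Qed.

HB.instance Definition _ (f : dual_space) :=
  GRing.isLinear.Build R X R^o _ (dual_fun f) (dual_linear f).

Lemma dual_continuous (f : dual_space) : continuous f.
Proof. by case: f => f /=; rewrite inE => -[]. Qed.

Lemma dual_supbounded (f : dual_space) : supbounded [set x | `|x| <= 1] f.
Proof.
have /linear_bounded_continuous/bounded_funP/(_ 1)[M fM] := @dual_continuous f.
by exists M => _ [x x1 <-]; exact: fM.
Qed.

Definition dual_norm (f : dual_space) : R := supnorm [set x | `|x| <= 1] f.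

Let dual_normD f g : dual_norm (f + g) <= dual_norm f + dual_norm g.
Proof. exact: supnormD (dual_supbounded f) (dual_supbounded g). Qed.

Let dual_normZ a f : dual_norm (a *: f) = `|a| * dual_norm f.
Proof. exact: supnormZ (dual_supbounded f). Qed.

Let dual_norm_eq0 f : dual_norm f = 0 -> f = 0.
Proof.
move=> f0; apply: val_inj; apply/funext => x /=.
rewrite [RHS]/(0 : R); have [->|x0] := eqVneq x 0; first by rewrite linear0.
have x0' : `|x| != 0 by rewrite normr_eq0.
have -> : x = `|x| *: (`|x|^-1 *: x) by rewrite scalerA divff// scale1r.
rewrite linearZ/=; suff -> : f (`|x|^-1 *: x) = 0 by rewrite scaler0.
apply/eqP; rewrite -normr_le0 -f0.
apply: (supnorm_ub (dual_supbounded f)) => /=.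
by rewrite normrZ normfV normr_id mulVf.
Qed.

HB.instance Definition _ :=
  Lmodule_isNormed.Build R dual_space dual_normD dual_normZ dual_norm_eq0.

Lemma dual_normE (f : dual_space) :
  `|f| = sup [set `|f x| | x in [set x | `|x| <= 1]].
Proof. by []. Qed.

End dual_space.

Section L1.
Context d (T : measurableType d) (R : realType).
Variable mu : {measure set T -> \bar R}.

Local Notation Lfun1 := (LfunType mu (lexx 1%E)).
Local Open Scope quotient_scope.

Definition ae_eq_Lfun (f g : Lfun1) := `[< f = g %[ae mu] >].

Let ae_eq_Lfun_refl : reflexive ae_eq_Lfun.
Proof. by move=> f; apply/asboolP; exact: ae_eq_refl. Qed.

Let ae_eq_Lfun_sym : symmetric ae_eq_Lfun.
Proof.
by move=> f g; apply/idP/idP => /asboolP fg; apply/asboolP; exact: ae_eq_sym.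
Qed.

Let ae_eq_Lfun_trans : transitive ae_eq_Lfun.
Proof.
move=> g f h /asboolP fg /asboolP gh; apply/asboolP.
exact: ae_eq_trans fg gh.
Qed.

Canonical ae_eq_Lfun_equiv :=
  EquivRel ae_eq_Lfun ae_eq_Lfun_refl ae_eq_Lfun_sym ae_eq_Lfun_trans.

(* [LspaceType1 mu] is the same set of classes, but it carries no algebraic
   structure, and its elements are measurable for [measurableTypeR R], whose
   display differs from that of [R] in [LfunType]. *)
Definition L1 : Type := {eq_quot ae_eq_Lfun}.
HB.instance Definition _ := Choice.on L1.
HB.instance Definition _ := EqQuotient.on L1.

Lemma L1_ind (P : L1 -> Prop) : (forall f, P (\pi_L1 f)) -> forall x, P x.
Proof. exact: quotW. Qed.

Lemma L1_piP (f g : Lfun1) : \pi_L1 f = \pi_L1 g <-> f = g %[ae mu].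
Proof.
split=> [/eqP|fg].
  by rewrite eqmodE => /asboolP.
by apply/eqP; rewrite eqmodE; apply/asboolP.
Qed.

Lemma L1_reprK (f : Lfun1) : repr (\pi_L1 f) = f %[ae mu].
Proof. by apply/L1_piP; rewrite reprK. Qed.

Definition L1_add (x y : L1) : L1 := \pi_L1 (repr x + repr y).
Definition L1_opp (x : L1) : L1 := \pi_L1 (- repr x).
Definition L1_scale (a : R) (x : L1) : L1 := \pi_L1 (a *: repr x).

Let piD (f g : Lfun1) : L1_add (\pi_L1 f) (\pi_L1 g) = \pi_L1 (f + g).
Proof.
apply/L1_piP; near=> x => _ /=; congr (_ + _).
- by near: x; apply: filterS (L1_reprK f) => x; exact.
- by near: x; apply: filterS (L1_reprK g) => x; exact.
Unshelve. all: by end_near. Qed.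

Let piN (f : Lfun1) : L1_opp (\pi_L1 f) = \pi_L1 (- f).
Proof.
apply/L1_piP; near=> x => _ /=; congr (- _).
by near: x; apply: filterS (L1_reprK f) => x; exact.
Unshelve. all: by end_near. Qed.

Let piZ a (f : Lfun1) : L1_scale a (\pi_L1 f) = \pi_L1 (a *: f).
Proof.
apply/L1_piP; near=> x => _ /=; congr (_ * _).
by near: x; apply: filterS (L1_reprK f) => x; exact.
Unshelve. all: by end_near. Qed.

Let addA : associative L1_add.
Proof.
move=> x y z; elim/L1_ind: x => f; elim/L1_ind: y => g; elim/L1_ind: z => h.
by rewrite !piD addrA.
Qed.

Let addC : commutative L1_add.
Proof.
by move=> x y; elim/L1_ind: x => f; elim/L1_ind: y => g; rewrite !piD addrC.
Qed.

Let add0 : left_id (\pi_L1 0) L1_add.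
Proof. by move=> x; elim/L1_ind: x => f; rewrite piD add0r. Qed.

Let addN : left_inverse (\pi_L1 0) L1_opp L1_add.
Proof. by move=> x; elim/L1_ind: x => f; rewrite piN piD addNr. Qed.

HB.instance Definition _ := GRing.isZmodule.Build L1 addA addC add0 addN.

Let scaleA a b x : L1_scale a (L1_scale b x) = L1_scale (a * b) x.
Proof. by elim/L1_ind: x => f; rewrite !piZ scalerA. Qed.

Let scale1 : left_id 1 L1_scale.
Proof. by move=> x; elim/L1_ind: x => f; rewrite piZ scale1r. Qed.

Let scaleDr : right_distributive L1_scale +%R.
Proof.
move=> a x y; elim/L1_ind: x => f; elim/L1_ind: y => g.
by rewrite [_ + _]piD !piZ [RHS]piD scalerDr.
Qed.

Let scaleDl x : {morph L1_scale^~ x : a b / a + b}.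
Proof. by move=> a b; elim/L1_ind: x => f; rewrite !piZ [RHS]piD scalerDl. Qed.

HB.instance Definition _ :=
  GRing.Zmodule_isLmodule.Build R L1 scaleA scale1 scaleDr scaleDl.

Lemma L1_piD (f g : Lfun1) : \pi_L1 (f + g) = \pi_L1 f + \pi_L1 g.
Proof. by rewrite [RHS]piD. Qed.

Lemma L1_piZ a (f : Lfun1) : \pi_L1 (a *: f) = a *: \pi_L1 f.
Proof. by rewrite [RHS]piZ. Qed.

Let Lfun1_norm (f : Lfun1) : R := fine ('N[mu]_1[EFin \o f])%E.

Definition L1_norm (x : L1) : R := Lfun1_norm (repr x).

Let L1_norm_pi (f : Lfun1) : L1_norm (\pi_L1 f) = Lfun1_norm f.
Proof.
rewrite /L1_norm /Lfun1_norm !Lnorm1; congr fine.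
have mf (g : Lfun1) : measurable_fun setT (abse \o (EFin \o g) : T -> \bar R).
  by apply: measurableT_comp => //; apply/measurable_EFinP.
apply: ae_eq_integral; [by []|exact: mf|exact: mf|].
exact: (ae_eq_comp (fun r : R => `|r%:E|%E) (L1_reprK f)).
Qed.

Let L1_normD x y : L1_norm (x + y) <= L1_norm x + L1_norm y.
Proof.
elim/L1_ind: x => f; elim/L1_ind: y => g.
by rewrite -L1_piD !L1_norm_pi; exact: ler_LnormD.
Qed.

Let L1_normZ a x : L1_norm (a *: x) = `|a| * L1_norm x.
Proof.
elim/L1_ind: x => f; rewrite -L1_piZ !L1_norm_pi; apply/EFin_inj.
by rewrite /Lfun1_norm EFinM !finite_norm_fine; exact: LnormZ.
Qed.

Let L1_norm_eq0 x : L1_norm x = 0 -> x = 0.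
Proof.
elim/L1_ind: x => f; rewrite L1_norm_pi => /fine_Lnormr_eq0 f0.
exact/L1_piP.
Qed.

HB.instance Definition _ :=
  Lmodule_isNormed.Build R L1 L1_normD L1_normZ L1_norm_eq0.

Lemma L1_normE (f : Lfun1) : (`|\pi_L1 f|%:E = \int[mu]_x `|(f x)%:E|)%E.
Proof.
by rewrite [`|_|%R]L1_norm_pi finite_norm_fine Lnorm1.
Qed.

End L1.

Section banach_spaces.
Context {R : realType}.

Definition isometrically_isomorphic (U V : normedModType R) :=
  exists f : {linear U -> V}, bijective f /\ forall x, `|f x| = `|x|.

Definition isomorphic (U V : normedModType R) :=
  exists (f : {linear U -> V}) (g : {linear V -> U}),
    [/\ cancel f g, cancel g f, continuous f & continuous g].

Definition lindenstrauss (X : completeNormedModType R) :=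
  exists (d : measure_display) (T : measurableType d)
         (mu : {measure set T -> \bar R}),
    isometrically_isomorphic (dual_space X) (L1 mu).

(* Exactness of 0 -> Y -> Z -> X -> 0 at Y, Z and X respectively: the image of
   0 -> Y is [set 0] and the kernel of X -> 0 is setT. *)
Definition short_exact_sequence (Y Z X : completeNormedModType R)
    (j : {linear Y -> Z}) (q : {linear Z -> X}) :=
  [/\ bounded_fun_norm j, bounded_fun_norm q,
      j @^-1` [set 0] = [set 0],
      q @^-1` [set 0] = range j &
      [set: X] = range q].

End banach_spaces.

(* Main.v *)
Require Import Defs.
From HB Require Import structures.
From mathcomp Require Import all_boot all_order all_algebra finmap.
From mathcomp Require Import all_classical all_reals all_analysis.
From mathcomp Require Import measurable_realfun.
From mathcomp Require Import ring lra.
Import Order.TTheory GRing.Theory Num.Theory.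
Import numFieldNormedType.Exports.

(** Why the theorem holds.  The given sequence need not split, but the dual
sequence 0 -> X^* -> Z^* -> l1(kappa) -> 0 always does, since l1(kappa) is
projective.  What has to be shown is that Z carries an equivalent norm for
which Z^* is the l1-sum of X^* and l1(kappa) not only up to isomorphism but
isometrically: if X^* = L1(mu), then Z^* is the L1 space of the disjoint sum
of mu and of the counting measure of kappa.

The norm is |z|' = max (|q z|, sup_i |v_i z|), where the functionals v_i extend
a small multiple c of the coordinates: v_i (j y) = c y_i.  They exist, with
|v_i z| <= d |z| for d as small as desired, by the open mapping theorem
(j is bounded below) and the Hahn-Banach theorem; this is
[coordinate_extension].

The point is the choice of d.  The open mapping theorem also provides K such
that every z is within K |q z| of some j y, so that for d = 1/(2K)
  |v_i z| <= 1/2 |q z| + c |y_i|     ([coordinate_le]).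
As y vanishes at infinity, a vector z with |q z| <= 1 satisfies |v_i z| <= 1
for all but finitely many i ([coordinate_finite]).  In terms of the dual ball,
the weak-star cluster points at infinity of the family (v_i) lie in the ball of
X^*, so that the unit ball of the l1-sum is already weak-star closed.

Consequently the functional f o q + sum_i b_i v_i has norm exactly
|f| + sum_i |b_i| ([twisted_norm]): a vector z with |q z| <= 1 that nearly
norms f can be modified in finitely many coordinates, along j, which leaves
f (q z) unchanged, in such a way that v_i z is the sign of b_i on any given
finite set while |v_i z| <= 1 everywhere.  And every functional phi has this
form ([twisted_surj]): take b_i = phi (e_i), with e_i the unit vectors
normalised by v_i e_i = 1; the remainder vanishes on the span of the e_i, hence
on the image of j, and factors through q ([factor_through_quotient]). *)

Set Implicit Arguments.
Unset Strict Implicit.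
Unset Printing Implicit Defensive.

Local Open Scope classical_set_scope.
Local Open Scope ring_scope.

(** * The Hahn-Banach theorem *)

Section hahn_banach.
Context {R : realType} {V : lmodType R}.
Implicit Types (p : V -> R) (x y : V).

Definition sublinear p :=
  (forall x y, p (x + y) <= p x + p y) /\
  (forall a x, 0 < a -> p (a *: x) <= a * p x).

Lemma sublinear0 p : sublinear p -> p 0 = 0.
Proof.
move=> [_ pZ]; have ltr02 : (0 : R) < 2 by [].
have h2 : (0 : R) < 2^-1 by rewrite invr_gt0.
have := pZ 2 0 ltr02; have := pZ _ 0 h2; rewrite !scaler0.
move: (p 0) => t th t2; apply/eqP; rewrite eq_le; apply/andP; split; lra.
Qed.

Lemma sublinearZ p a x : sublinear p -> 0 <= a -> p (a *: x) = a * p x.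
Proof.
move=> sp; rewrite le_eqVlt => /predU1P[<-|a0].
  by rewrite scale0r mul0r sublinear0.
apply/eqP; rewrite eq_le sp.2//= -ler_pdivlMl//.
have := sp.2 a^-1 (a *: x).
by rewrite scalerA mulVf ?gt_eqF// scale1r invr_gt0; exact.
Qed.

Lemma sublinear_geN p x : sublinear p -> - p (- x) <= p x.
Proof.
move=> sp; rewrite lerNl -subr_ge0 opprK -(sublinear0 sp) -(subrr x) addrC.
exact: sp.1.
Qed.

(** For a cone [K] of pairs (u, r), this is the infimum over [K] of
p (x + u) + r.  It is the only construction of smaller sublinear functionals
used below: the cone spanned by (v, - p v) shows that minimal functionals are
odd, and the graph of - g over the image of j forces an extension of g. *)
Lemma sublinear_cone p (K : set (V * R)) : sublinear p -> K (0, 0) ->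
    (forall u v, K u -> K v -> K (u.1 + v.1, u.2 + v.2)) ->
    (forall a u, 0 < a -> K u -> K (a *: u.1, a * u.2)) ->
    (forall u, K u -> 0 <= p u.1 + u.2) ->
  exists p', [/\ sublinear p', forall x, p' x <= p x &
    forall u, K u -> p' (- u.1) <= u.2].
Proof.
move=> sp K0 KD KZ Kp.
pose S x := [set p (x + u.1) + u.2 | u in K].
have lbS x : lbound (S x) (- p (- x)).
  move=> _ [u Ku <-].
  have := sp.1 (x + u.1) (- x); rewrite addrAC subrr add0r => h.
  by have := Kp u Ku; lra.
have hS x : has_inf (S x).
  by split; [exists (p (x + 0) + 0); exists (0, 0)|exists (- p (- x))].
have leS x u : K u -> inf (S x) <= p (x + u.1) + u.2.
  by move=> Ku; apply: ge_inf; [exact: (hS x).2|exists u].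
exists (fun x => inf (S x)); split.
- split.
    move=> x y; rewrite -lerBlDr; apply: lb_le_inf; first exact: (hS x).1.
    move=> _ [u Ku <-]; rewrite lerBlDl -lerBlDr.
    apply: lb_le_inf; first exact: (hS y).1.
    move=> _ [v Kv <-]; have := leS (x + y) _ (KD u v Ku Kv).
    have := sp.1 (x + u.1) (y + v.1); rewrite addrACA /=; lra.
  move=> a x a0; rewrite -ler_pdivrMl//; apply: lb_le_inf; first exact: (hS x).1.
  move=> _ [u Ku <-]; rewrite ler_pdivrMl//.
  apply: le_trans (leS _ _ (KZ a u a0 Ku)) _ => /=.
  by rewrite -scalerDr mulrDr lerD2r; exact: sp.2.
- by move=> x; have := leS x _ K0; rewrite /= !addr0.
- move=> u Ku; apply: le_trans (leS _ _ Ku) _.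
  by rewrite addNr sublinear0// add0r.
Qed.

(** Zorn's lemma for the reverse pointwise order: the infimum of a chain of
sublinear functionals is finite, as each of them is bounded below by
- p (- x), and it is subadditive because two members of a chain are
comparable. *)
Lemma sublinear_minimal p : sublinear p ->
  exists f, [/\ sublinear f, forall x, f x <= p x &
    forall g, sublinear g -> (forall x, g x <= f x) -> g = f].
Proof.
move=> sp; pose T := {f : V -> R | sublinear f /\ forall x, f x <= p x}.
pose Rel (s t : T) := `[< forall x, sval t x <= sval s x >].
have [| | | |f fmin] := @Zorn T Rel.
- by move=> t; apply/asboolP.
- move=> r s t /asboolP rs /asboolP st; apply/asboolP => x.
  exact: le_trans (st x) (rs x).
- move=> [s Ps] [t Pt] /asboolP/= st /asboolP/= ts.
  suff st' : s = t by subst t; congr exist; exact: Prop_irrelevance.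
  by apply/funext => x; apply/eqP; rewrite eq_le st ts.
- move=> A totA; have [A0|/set0P[s0 As0]] := eqVneq A set0.
    exists (exist _ p (conj sp (fun x => lexx _))) => s.
    by rewrite A0.
  pose S x := [set sval s x | s in A].
  have hS x : has_inf (S x).
    split; first by exists (sval s0 x); exists s0.
    exists (- p (- x)) => _ [s As <-]; have [ss sp'] := svalP s.
    by apply: le_trans (sublinear_geN x ss); rewrite lerN2.
  have leS x s : A s -> inf (S x) <= sval s x.
    by move=> As; apply: ge_inf; [exact: (hS x).2|exists s].
  have sS : sublinear (fun x => inf (S x)).
    split.
      move=> x y; rewrite -lerBlDr; apply: lb_le_inf; first exact: (hS x).1.
      move=> _ [s As <-]; rewrite lerBlDl -lerBlDr.
      apply: lb_le_inf; first exact: (hS y).1.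
      move=> _ [t At <-].
      have [/asboolP st|/asboolP ts] := totA s t As At.
        have := (svalP t).1.1 x y; have := leS (x + y) t At; have := st x.
        rewrite /=; lra.
      have := (svalP s).1.1 x y; have := leS (x + y) s As; have := ts y.
      rewrite /=; lra.
    move=> a x a0; rewrite -ler_pdivrMl//; apply: lb_le_inf; first exact: (hS x).1.
    move=> _ [s As <-]; rewrite ler_pdivrMl//.
    by apply: le_trans (leS _ _ As) _; exact: (svalP s).1.2.
  have Sp x : inf (S x) <= p x.
    exact: le_trans (leS x _ As0) ((svalP s0).2 x).
  pose t : T := exist (fun f => sublinear f /\ forall x, f x <= p x)
    (fun x => inf (S x)) (conj sS Sp).
  exists t => s As; apply/asboolP => x /=; exact: leS.
- exists (sval f); have [sf fp] := svalP f; split=> // g sg gf.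
  have gp x : g x <= p x := le_trans (gf x) (fp x).
  by rewrite -(fmin (exist _ g (conj sg gp)))//; apply/asboolP.
Qed.

(** Lowering [f] at - v to - f v by [sublinear_cone] does not change a
minimal [f]; so [f] is odd, and an odd subadditive function is additive. *)
Lemma minimal_sublinear_linear f : sublinear f ->
  (forall g, sublinear g -> (forall x, g x <= f x) -> g = f) ->
  linear (f : V -> R^o).
Proof.
move=> sf fmin.
have fN v : f (- v) = - f v.
  apply/eqP; rewrite eq_le; apply/andP; split; last first.
    by have := sublinear_geN (- v) sf; rewrite opprK.
  pose K : set (V * R) := [set u | exists2 t, 0 <= t & u = (t *: v, - (t * f v))].
  have [|u u'|a u a0|u|g [sg gf gK]] := @sublinear_cone f K sf.
  - by exists 0; rewrite ?scale0r ?mul0r ?oppr0.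
  - move=> [t t0 ->] [t' t0' ->]; exists (t + t'); first exact: addr_ge0.
    by rewrite /= scalerDl mulrDl opprD.
  - move=> [t t0 ->]; exists (a * t); first by rewrite mulr_ge0// ltW.
    by rewrite /= scalerA -mulrA mulrN.
  - by move=> [t t0 ->] /=; rewrite sublinearZ// subrr.
  rewrite -(fmin g sg gf); have := gK (v, - f v); rewrite (fmin g)//=; apply.
  by exists 1; rewrite ?scale1r ?mul1r.
have fD x y : f (x + y) = f x + f y.
  apply/eqP; rewrite eq_le sf.1/= -[leRHS]opprK -fN opprD lerNr.
  by apply: le_trans (sf.1 _ _) _; rewrite !fN -opprD.
move=> a x y; rewrite fD; congr (_ + _).
have [a0|a0] := leP 0 a; first exact: sublinearZ.
rewrite -[a in LHS]opprK scaleNr fN sublinearZ// ?oppr_ge0 1?ltW//.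
by rewrite mulNr opprK.
Qed.

End hahn_banach.

(** The subspace is the image of [j]; on it [g] induces a functional, because
the domination of [g] makes it constant on the fibres of [j]. *)
Theorem hahn_banach (R : realType) (U V : lmodType R) (j : {linear U -> V})
    (g : {linear U -> R^o}) (p : V -> R) : sublinear p ->
    (forall u, g u <= p (j u)) ->
  exists f : {linear V -> R^o}, (forall u, f (j u) = g u) /\ forall x, f x <= p x.
Proof.
move=> sp gp.
pose K : set (V * R) := [set u | exists y, u = (j y, - (g y : R))].
have [|u u'|a u a0|u|p' [sp' p'p p'K]] := @sublinear_cone _ _ p K sp.
- exists 0; have -> : g 0 = 0 :> R by exact: linear0.
  by rewrite linear0 oppr0.
- by move=> [t ->] [t' ->]; exists (t + t'); rewrite /= !linearD.
- move=> [t ->]; exists (a *: t).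
  have -> : g (a *: t) = a * g t :> R by exact: linearZ.
  by rewrite linearZ mulrN.
- by move=> [t ->] /=; rewrite subr_ge0.
have [f [sf fp' fmin]] := sublinear_minimal sp'.
pose F : {linear V -> R^o} :=
  HB.pack f (GRing.isLinear.Build R V R^o _ f (minimal_sublinear_linear sf fmin)).
have le u : F (- j u) <= - (g u : R).
  by apply: le_trans (fp' _) _; apply: (p'K (j u, _)); exists u.
exists F; split => [u|x]; last exact: le_trans (fp' x) (p'p x).
apply/eqP; rewrite eq_le; apply/andP; split.
  by have := le (- u); rewrite -linearN opprK linearN opprK.
by have := le u; rewrite linearN lerN2.
Qed.

(** * The open mapping theorem *)

Lemma bounded_fun_normP (R : realType) (V W : normedModType R)
    (T : {linear V -> W}) : bounded_fun_norm T ->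
  exists2 C : R, 0 < C & forall x, `|T x| <= C * `|x|.
Proof.
move=> /(_ 1)[M TM]; exists (`|M| + 1) => [|x]; first by rewrite ltr_wpDl.
have [->|x0] := eqVneq x 0; first by rewrite linear0 !normr0 mulr0.
have nx : 0 < `|x| by rewrite normr_gt0.
have := TM (`|x|^-1 *: x); rewrite linearZ !normrZ normfV normr_id mulVf ?gt_eqF//.
move=> /(_ (lexx _)); rewrite ler_pdivrMl// mulrC => /le_trans; apply.
by rewrite ler_pM2r//; apply: le_trans (ler_norm M) _; rewrite lerDl.
Qed.

Lemma bounded_fun_norm_continuous (R : realType) (V W : normedModType R)
    (T : {linear V -> W}) : bounded_fun_norm T -> continuous T.
Proof. by move=> bT; apply/linear_bounded_continuous/bounded_funP. Qed.

Lemma linear_le_bounded (R : realType) (V W : normedModType R)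
    (T : {linear V -> W}) (C : R) : (forall x, `|T x| <= C * `|x|) ->
  bounded_fun_norm T.
Proof.
move=> TC r; exists (`|C| * r) => x xr; apply: le_trans (TC x) _.
apply: (@le_trans _ _ (`|C| * `|x|)); first by rewrite ler_wpM2r// ler_norm.
by rewrite ler_wpM2l.
Qed.

Section open_mapping.
Context {R : realType} {E F : completeNormedModType R}.
Variable T : {linear E -> F}.
Hypothesis surjT : forall y, exists x, T x = y.

(** Baire's theorem: the closures of the images of the balls of integer
radius cover [F], so one of them has interior points; differences of points
near such a point fill a neighbourhood of 0. *)
Lemma surj_approx_ball : exists (r M : R), 0 < r /\
  forall y, `|y| < r -> forall e, 0 < e -> exists2 x, `|x| <= M & `|y - T x| < e.
Proof.
pose C n := closure (T @` [set x | `|x| <= n%:R]).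
have [n Cn] : exists n, ~ dense (~` C n).
  apply: contrapT => /forallNP nC.
  have : dense (\bigcap_n (~` C n)).
    apply: Baire => n; split; last exact: contrapT (nC n).
    by apply: closed_openC; exact: closed_closure.
  move=> /(_ setT) [|//|z [_ Cz]]; first by exists 0.
    exact: openT.
  have [x Tx] := surjT z; apply: (Cz (Num.truncn `|x|).+1 I); apply: subset_closure.
  by exists x => //=; apply: ltW; exact: truncnS_gt.
have [U [[y0 [openU Uy0]] UC]] := denseNE Cn.
have subU : U `<=` C n.
  by move=> z Uz; apply: contrapT => nCz; rewrite -[False]/(set0 z) -UC.
have [r r0 rU] : exists2 r : R, 0 < r & ball y0 r `<=` U.
  by apply/nbhs_ballP; exact: open_nbhs_nbhs.
have approx z e : U z -> 0 < e -> exists2 x, `|x| <= n%:R & `|z - T x| < e.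
  move=> /subU Cz e0; have [_ [[x xn <-]]] := Cz _ (nbhsx_ballx z e e0).
  by rewrite -ball_normE /= => h; exists x.
exists r, (n%:R + n%:R); split=> // y yr e e0.
have e2 : 0 < e / 2 by rewrite divr_gt0.
have [|x1 x1n h1] := approx (y0 + y) (e / 2) _ e2.
  by apply: rU; rewrite -ball_normE /= opprD addNKr normrN.
have [x2 x2n h2] := approx y0 (e / 2) Uy0 e2.
exists (x1 - x2); first by apply: le_trans (ler_normB _ _) _; exact: lerD.
rewrite linearB (_ : y - _ = (y0 + y - T x1) - (y0 - T x2)); last first.
  rewrite !opprB (addrC y0) -!addrA; congr (_ + _).
  by rewrite [RHS]addrC -!addrA addNr addr0 addrC.
by apply: le_lt_trans (ler_normB _ _) _; rewrite (splitr e); exact: ltrD.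
Qed.

(** [surj_approx_ball] in scale-invariant form, ready to be iterated. *)
Lemma surj_approx : exists2 K : R, 0 < K &
  forall y, exists x, `|x| <= K * `|y| /\ `|y - T x| <= 2^-1 * `|y|.
Proof.
have [r [M [r0 rM]]] := surj_approx_ball.
exists (2 / r * (`|M| + 1)).
  by rewrite mulr_gt0 ?divr_gt0// ltr_wpDl.
move=> y; have [->|y0] := eqVneq y 0.
  by exists 0; rewrite linear0 subr0 !normr0 !mulr0.
have ny : 0 < `|y| by rewrite normr_gt0.
pose t := r / 2 / `|y|; have t0 : 0 < t by rewrite !divr_gt0.
have ty : t * `|y| = r / 2 by rewrite /t divfK ?gt_eqF.
have tyr : `|t *: y| < r by rewrite normrZ gtr0_norm// ty; lra.
have r4 : 0 < r / 4 by rewrite divr_gt0.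
have [x xM xy] := rM _ tyr _ r4.
exists (t^-1 *: x); split.
  rewrite normrZ normfV (gtr0_norm t0) ler_pdivrMl//.
  have -> : t * (2 / r * (`|M| + 1) * `|y|) = `|M| + 1.
    rewrite mulrCA ty; field; exact: lt0r_neq0.
  by apply: le_trans xM _; apply: le_trans (ler_norm M) _; rewrite lerDl.
have -> : y - T (t^-1 *: x) = t^-1 *: (t *: y - T x).
  by rewrite linearZ scalerBr scalerA mulVf ?gt_eqF// scale1r.
rewrite normrZ normfV (gtr0_norm t0) ler_pdivrMl// mulrCA ty.
by apply: le_trans (ltW xy) _; lra.
Qed.

(** Solving T x = y up to an error at most |y| / 2 and starting again with
the error, the corrections decrease geometrically, and completeness of [E]
sums them to an exact solution. *)
Theorem open_mapping : bounded_fun_norm T ->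
  exists2 K : R, 0 < K & forall y, exists2 x, T x = y & `|x| <= K * `|y|.
Proof.
move=> bT; have [K K0 /choice[h hP]] := surj_approx.
exists (K * 2) => [|y]; first by rewrite mulr_gt0.
pose f := fix f n := if n is m.+1 then f m - T (h (f m)) else y.
have fn n : `|f n| <= `|y| * 2^-1 ^+ n.
  elim: n => [|n IH]; first by rewrite expr0 mulr1.
  rewrite exprS mulrCA; apply: le_trans (hP (f n)).2 _.
  by rewrite ler_wpM2l.
pose u n := h (f n).
have un n : `|u n| <= geometric (K * `|y|) 2^-1 n.
  apply: le_trans (hP _).1 _; rewrite /= -mulrA ler_wpM2l ?(ltW K0)//.
have half : `|2^-1 : R| < 1 by rewrite ger0_norm//; lra.
have cg := @is_cvg_geometric_series R (K * `|y|) _ half.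
have cn : cvgn [normed series u].
  apply: series_le_cvg un cg => // n /=; rewrite mulr_ge0// mulr_ge0//.
  exact: ltW.
have cu := normed_cvg cn.
have Tu n : T (series u n) = y - f n.
  elim: n => [|n IH]; first by rewrite seriesEnat /= big_geq// linear0 subrr.
  by rewrite seriesSr linearD IH /= /u opprB addrA addrAC.
exists (limn (series u)).
  have cT : T (series u n) @[n --> \oo] --> T (limn (series u)).
    by apply: continuous_cvg => //; exact: bounded_fun_norm_continuous.
  have f0 : f n @[n --> \oo] --> (0 : F).
    apply/norm_cvg0P.
    apply: (@squeeze_cvgr _ _ _ _ (cst 0) (geometric `|y| 2^-1)).
    - by apply: nearW => n; rewrite normr_ge0 /= fn.
    - exact: cvg_cst.
    - exact: cvg_geometric.
  have cy : T (series u n) @[n --> \oo] --> y.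
    rewrite (_ : (fun n => _) = (fun n => y - f n)); last exact/funext.
    have : y - f n @[n --> \oo] --> y - 0 by apply: cvgB => //; exact: cvg_cst.
    by rewrite subr0.
  exact: (cvg_unique _ cT cy).
apply: le_trans (lim_series_norm cn) _.
apply: le_trans (lim_series_le cn cg un) _.
rewrite (cvg_lim _ (cvg_geometric_series (a := K * `|y|) half))//.
by rewrite (_ : 1 - 2^-1 = 2^-1) ?invrK 1?mulrAC//; lra.
Qed.

End open_mapping.

(** * Short exact sequences of Banach spaces *)

(** A complete norm on a bare vector space.  Completeness is expressed
without a topology on [V], so that the record can be filled before [V]
receives the topology of the norm. *)
Record banach_norm (R : realType) (V : lmodType R) := BanachNorm {
  bnorm :> V -> R ;
  bnormD : forall x y, bnorm (x + y) <= bnorm x + bnorm y ;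
  bnormZ : forall a x, bnorm (a *: x) = `|a| * bnorm x ;
  bnorm_eq0 : forall x, bnorm x = 0 -> x = 0 ;
  bnorm_complete : forall F : set_system V, ProperFilter F ->
    (forall e, 0 < e -> exists x, F [set y | bnorm (x - y) < e]) ->
    exists l, forall e, 0 < e -> F [set y | bnorm (l - y) < e] }.

(** An alias: [V] itself may already carry another norm. *)
Definition normed_by (R : realType) (V : lmodType R) (N : banach_norm V) : Type := V.

Section normed_by.
Context (R : realType) (V : lmodType R) (N : banach_norm V).

HB.instance Definition _ := GRing.Lmodule.on (normed_by N).
HB.instance Definition _ :=
  Lmodule_isNormed.Build R (normed_by N) (bnormD N) (bnormZ N) (@bnorm_eq0 _ _ N).

Lemma normed_byE (x : normed_by N) : `|x| = N x.
Proof. by []. Qed.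

Lemma normed_by_complete (F : set_system (normed_by N)) :
  ProperFilter F -> cauchy F -> cvg F.
Proof.
move=> FF /cauchyP Fc.
have [e e0|l Fl] := @bnorm_complete _ _ N F FF.
  have [x] := Fc e e0; rewrite -ball_normE => xF; exists x; exact: xF.
apply/cvg_ex; exists l; apply/cvgrPdist_lt => e e0; exact: Fl.
Qed.

HB.instance Definition _ := Uniform_isComplete.Build (normed_by N) normed_by_complete.
End normed_by.

Section exact_sequence.
Context (R : realType) (Y Z X : completeNormedModType R).
Variables (j : {linear Y -> Z}) (q : {linear Z -> X}).
Hypothesis exact_jq : short_exact_sequence j q.

Lemma exact_comp0 y : q (j y) = 0.
Proof.
have [_ _ _ kerq _] := exact_jq.
suff : (q @^-1` [set 0]) (j y) by [].
by rewrite kerq; exists y.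
Qed.

Lemma exact_ker z : q z = 0 -> exists y, j y = z.
Proof.
have [_ _ _ kerq _] := exact_jq.
move=> qz; have : (q @^-1` [set 0]) z by [].
by rewrite kerq => -[y _ <-]; exists y.
Qed.

(** The norm |j y| on [Y] is complete because the image of [j], a kernel, is
closed; the open mapping theorem for the identity of [Y] compares it with the
norm of [Y]. *)
Lemma exact_bounded_below : exists2 C : R, 0 < C & forall y, `|y| <= C * `|j y|.
Proof.
have [bj bq kerj _ _] := exact_jq.
have j0 y : j y = 0 -> y = 0.
  by move=> jy; have : (j @^-1` [set 0]) y by []; rewrite kerj.
pose n (y : Y) := `|j y|.
have nD x y : n (x + y) <= n x + n y by rewrite /n linearD ler_normD.
have nZ a x : n (a *: x) = `|a| * n x by rewrite /n linearZ normrZ.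
have n0 x : n x = 0 -> x = 0 by move=> /normr0_eq0; exact: j0.
have nC (F : set_system Y) : ProperFilter F ->
    (forall e, 0 < e -> exists x, F [set y | n (x - y) < e]) ->
    exists l, forall e, 0 < e -> F [set y | n (l - y) < e].
  move=> FF Fc.
  have : cvg (j @ F).
    apply: cauchy_cvg; apply: cauchy_exP => e e0.
    have [x Fx] := Fc e e0; exists (j x).
    suff : F (j @^-1` ball (j x) e) by [].
    apply: filterS Fx => y /=.
    by rewrite /n linearB -ball_normE.
  move=> /cvg_ex[z jz].
  have qz : q z = 0.
    have : q (j y) @[y --> F] --> q z.
      apply: continuous_cvg => //; exact: bounded_fun_norm_continuous.
    rewrite (_ : (fun y => _) = cst 0); last by apply/funext => x /=; rewrite exact_comp0.
    by move=> h; apply: (cvg_unique _ h) => //; exact: cvg_cst.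
  have [l jl] := exact_ker qz.
  exists l => e e0; move: jz => /cvgrPdist_lt/(_ e e0) Fz.
  have {Fz} : F [set y | `|z - j y| < e] by [].
  by apply: filterS => y /=; rewrite -jl -linearB.
pose N := BanachNorm nD nZ n0 nC.
pose idl : Y -> normed_by N := id.
pose T : {linear Y -> normed_by N} :=
  HB.pack idl (GRing.isLinear.Build R Y (normed_by N) _ idl (fun a x y => erefl)).
have bT : bounded_fun_norm T by exact: bj.
have [y|K K0 KT] := open_mapping _ bT; first by exists y.
by exists K => // y; have [x <-] := KT y.
Qed.

Lemma bounded_lift : exists2 K : R, 0 < K &
  forall x, exists2 z, q z = x & `|z| <= K * `|x|.
Proof.
have [_ bq _ _ surjq] := exact_jq.
apply: open_mapping bq => x.
have : [set: X] x by []; by rewrite surjq => -[z _ <-]; exists z.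
Qed.

End exact_sequence.

(** * L1 of a disjoint sum of measure spaces *)

Lemma integrable_Lfun d (T : measurableType d) (R : realType)
    (mu : {measure set T -> \bar R}) (f : T -> R) :
  mu.-integrable setT (EFin \o f) ->
  exists F : LfunType mu (lexx 1%E), (F : T -> R) = f.
Proof.
move=> /Lfun1_integrable Pf; exists (Lfun_Sub (lexx 1%E) Pf); exact: Lfun_valP.
Qed.

Lemma Lfun_integrableT d (T : measurableType d) (R : realType)
    (mu : {measure set T -> \bar R}) (f : LfunType mu (lexx 1%E)) :
  mu.-integrable setT (EFin \o f).
Proof. by apply/Lfun1_integrable; exact: LfunP. Qed.

Lemma Lfun_measurable d (T : measurableType d) (R : realType)
    (mu : {measure set T -> \bar R}) (f : LfunType mu (lexx 1%E)) :
  measurable_fun setT (f : T -> R).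
Proof. exact: measurable_funPT. Qed.

Section L1_comp.
Local Open Scope quotient_scope.
Context d d' (T : measurableType d) (T' : measurableType d') (R : realType).
Variables (mu : {measure set T -> \bar R}) (nu : {measure set T' -> \bar R}).
Variable phi : T' -> T.
Hypothesis mphi : measurable_fun setT phi.
Hypothesis nu_le : forall f : T -> \bar R, measurable_fun setT f ->
  (forall x, 0 <= f x)%E -> (\int[nu]_x f (phi x) <= \int[mu]_x f x)%E.

(** A null set of [mu] pulls back to a null set of [nu]: [nu_le] applied to its
indicator function.  This is what makes composition with [phi] well defined
on classes. *)
Lemma ae_comp (P : set T) : {ae mu, forall x, P x} -> {ae nu, forall x, P (phi x)}.
Proof.
move=> [A [mA A0 PA]]; exists (phi @^-1` A); split.
- by rewrite -[X in measurable X]setTI; exact: mphi.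
- apply/eqP; rewrite eq_le measure_ge0 andbT -A0.
  have mphiA : measurable (phi @^-1` A).
    by rewrite -[X in measurable X]setTI; exact: mphi.
  have -> : mu A = (\int[mu]_x (\1_A x)%:E)%E by rewrite integral_indic// setIT.
  have -> : nu (phi @^-1` A) = (\int[nu]_x (\1_A (phi x))%:E)%E.
    transitivity (\int[nu]_x (\1_(phi @^-1` A) x)%:E)%E.
      by rewrite integral_indic// setIT.
    by apply: eq_integral => x _; rewrite !indicE.
  apply: nu_le => [|x]; last by rewrite lee_fin.
  by apply/measurable_EFinP; exact: measurable_indic.
- by move=> x /= nPx; apply: PA.
Qed.

Lemma integrable_comp (f : LfunType mu (lexx 1%E)) :
  nu.-integrable setT (EFin \o (f \o phi)).
Proof.
have /integrableP[mf fi] := Lfun_integrableT f.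
apply/integrableP; split.
  by apply/measurable_EFinP; apply: measurableT_comp => //; exact: Lfun_measurable.
apply: le_lt_trans fi.
apply: (nu_le (f := fun x => `|(f x)%:E|%E)) => //.
by apply: measurableT_comp.
Qed.

Lemma L1_comp : exists P : {linear L1 mu -> L1 nu},
  forall f : LfunType mu (lexx 1%E), exists2 g : LfunType nu (lexx 1%E),
    (g : T' -> R) = f \o phi & P (\pi_(L1 mu) f) = \pi_(L1 nu) g.
Proof.
have /choice[c cE] : forall f : LfunType mu (lexx 1%E),
    exists g : LfunType nu (lexx 1%E), (g : T' -> R) = f \o phi.
  by move=> f; apply: integrable_Lfun; exact: integrable_comp.
pose P (x : L1 mu) : L1 nu := \pi_(L1 nu) (c (repr x)).
have PE (f : LfunType mu (lexx 1%E)) (g : LfunType nu (lexx 1%E)) :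
    (g : T' -> R) = f \o phi ->
    P (\pi_(L1 mu) f) = \pi_(L1 nu) g.
  move=> gE; apply/L1_piP; rewrite cE gE.
  have := ae_comp (L1_reprK f); apply: filterS => x /= h _; exact: h.
have lP : linear P.
  move=> a x y; elim/L1_ind: x => f; elim/L1_ind: y => g.
  rewrite -L1_piZ -L1_piD (PE _ (a *: c f + c g)); last first.
    by apply/funext => x /=; rewrite !cE.
  by rewrite L1_piD L1_piZ; congr (_ *: _ + _); apply/esym/PE.
pose Pl : {linear L1 mu -> L1 nu} :=
  HB.pack P (GRing.isLinear.Build R (L1 mu) (L1 nu) _ P lP).
by exists Pl => f; exists (c f) => //; exact: PE.
Qed.

End L1_comp.

Definition sum_space (T1 T2 : Type) : Type := (T1 + T2)%type.

Section sum_space.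
Local Open Scope quotient_scope.
Context d1 d2 (T1 : measurableType d1) (T2 : measurableType d2).
Notation S := (sum_space T1 T2).
Implicit Types A : set S.

HB.instance Definition _ := Choice.copy S (T1 + T2)%type.
HB.instance Definition _ := isPointed.Build S (inl point).

Definition inlS : T1 -> S := inl.
Definition inrS : T2 -> S := inr.

Definition sum_measurable A := measurable (inlS @^-1` A) /\ measurable (inrS @^-1` A).

Let sum_measurable0 : sum_measurable set0.
Proof. by split; rewrite preimage_set0. Qed.

Let sum_measurableC A : sum_measurable A -> sum_measurable (~` A).
Proof. by move=> [mA1 mA2]; split; rewrite preimage_setC; exact: measurableC. Qed.

Let sum_measurable_bigcup (F : (set S)^nat) :
  (forall i, sum_measurable (F i)) -> sum_measurable (\bigcup_i F i).
Proof.
by move=> mF; split; rewrite preimage_bigcup; apply: bigcup_measurable => i _;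
  case: (mF i).
Qed.

HB.instance Definition _ := isMeasurable.Build (measure_prod_display (d1, d2)) S
  sum_measurable0 sum_measurableC sum_measurable_bigcup.

Lemma measurable_inl : measurable_fun setT inlS.
Proof. by move=> _ A [mA _]; rewrite setTI. Qed.

Lemma measurable_inr : measurable_fun setT inrS.
Proof. by move=> _ A [_ mA]; rewrite setTI. Qed.

Lemma measurable_fun_sum d (U : measurableType d) (f : S -> U) :
  measurable_fun setT (f \o inlS) -> measurable_fun setT (f \o inrS) ->
  measurable_fun setT f.
Proof.
move=> m1 m2 _ A mA; rewrite setTI; split.
  by have := m1 measurableT A mA; rewrite setTI.
by have := m2 measurableT A mA; rewrite setTI.
Qed.

Context (R : realType).
Context (mu1 : {measure set T1 -> \bar R}) (mu2 : {measure set T2 -> \bar R}).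

(** The push-forward is a measure only because [inlS] is measurable; the packing
records this proof. *)
Let push1 : {measure set S -> \bar R}.
Proof.
unshelve refine (pushforward mu1 inlS : {measure set S -> \bar R}).
exact: measurable_inl.
Defined.

Let push2 : {measure set S -> \bar R}.
Proof.
unshelve refine (pushforward mu2 inrS : {measure set S -> \bar R}).
exact: measurable_inr.
Defined.

Definition sum_measure : {measure set S -> \bar R} := measure_add push1 push2.

Lemma ge0_integral_sum (f : S -> \bar R) : measurable_fun setT f ->
  (forall x, 0 <= f x)%E ->
  (\int[sum_measure]_x f x = \int[mu1]_x f (inlS x) + \int[mu2]_x f (inrS x))%E.
Proof.
move=> mf f0; rewrite ge0_integral_measure_add//; congr (_ + _)%E.
- by rewrite ge0_integral_pushforward//; exact: measurable_inl.
- by rewrite ge0_integral_pushforward//; exact: measurable_inr.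
Qed.

(** L1 of the sum is the l1-sum of the two L1 spaces: the two components are
restrictions, and any two classes can be glued. *)
Theorem L1_sum : exists (P1 : {linear L1 sum_measure -> L1 mu1})
    (P2 : {linear L1 sum_measure -> L1 mu2}),
  (forall x, `|x| = `|P1 x| + `|P2 x|) /\
  (forall x1 x2, exists x, P1 x = x1 /\ P2 x = x2).
Proof.
have [|P1 P1E] := @L1_comp _ _ _ _ R sum_measure mu1 _ measurable_inl.
  by move=> f mf f0; rewrite ge0_integral_sum// leeDl// integral_ge0.
have [|P2 P2E] := @L1_comp _ _ _ _ R sum_measure mu2 _ measurable_inr.
  by move=> f mf f0; rewrite ge0_integral_sum// leeDr// integral_ge0.
exists P1, P2; split.
  move=> x; elim/L1_ind: x => f.
  have [g1 g1E ->] := P1E f; have [g2 g2E ->] := P2E f.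
  apply: EFin_inj; rewrite EFinD !L1_normE g1E g2E ge0_integral_sum//.
  by apply: measurableT_comp => //; apply/measurable_EFinP; exact: Lfun_measurable.
move=> x1 x2; elim/L1_ind: x1 => f1; elim/L1_ind: x2 => f2.
pose f (x : S) : R := match x with inl t => f1 t | inr t => f2 t end.
have mf : measurable_fun setT f.
  by apply: measurable_fun_sum; [exact: (Lfun_measurable f1)|exact: (Lfun_measurable f2)].
have [F FE] : exists F : LfunType sum_measure (lexx 1%E), (F : S -> R) = f.
  apply: integrable_Lfun; apply/integrableP; split; first exact/measurable_EFinP.
  rewrite ge0_integral_sum//; last first.
    by apply: measurableT_comp => //; exact/measurable_EFinP.
  have /integrableP[_ i1] := Lfun_integrableT f1.
  have /integrableP[_ i2] := Lfun_integrableT f2.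
  exact: lte_add_pinfty.
have [g1 g1E P1F] := P1E F; have [g2 g2E P2F] := P2E F.
exists (\pi_(L1 sum_measure) F); split.
  by rewrite P1F; congr (\pi_(L1 mu1) _); apply/LfuneqP => t; rewrite g1E /= FE.
by rewrite P2F; congr (\pi_(L1 mu2) _); apply/LfuneqP => t; rewrite g2E /= FE.
Qed.

End sum_space.

(** * Summable families as L1 of a counting measure *)

(** [K] with the discrete sigma-algebra.  The point [k0] is a parameter of the
alias because measurable types are pointed. *)
Definition discrete_space (K : Type) (k0 : K) : Type := K.

Section discrete_space.
Context (K : Type) (k0 : K).
Notation D := (discrete_space k0).

HB.instance Definition _ := gen_eqMixin D.
HB.instance Definition _ := gen_choiceMixin D.
HB.instance Definition _ := isPointed.Build D k0.
HB.instance Definition _ := @isMeasurable.Build default_measure_display D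
  discrete_measurable discrete_measurable0 discrete_measurableC discrete_measurableU.

Lemma measurable_discrete d (U : measurableType d) (A : set D) (f : D -> U) :
  measurable_fun A f.
Proof. by []. Qed.

Context (R : realType).
Notation cnt := (@counting D R).

Lemma integral_counting1 (f : D -> \bar R) x : (\int[cnt]_(y in [set x]) f y = f x)%E.
Proof.
rewrite (eq_integral (cst (f x))); last by move=> y; rewrite inE => ->.
rewrite integral_cst// [X in (_ * X)%E]/(counting [set x]).
by rewrite /counting asboolT// fset_set1 cardfs1 mule1.
Qed.

Lemma integral_counting_seq (f : D -> \bar R) (s : seq D) : uniq s ->
  (forall x, 0 <= f x)%E ->
  (\int[cnt]_(x in [set` s]) f x = \sum_(x <- s) f x)%E.
Proof.
move=> + f0; elim: s => [_|x s IH /= /andP[xs us]].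
  by rewrite classical_sets.set_nil integral_set0 big_nil.
have -> : [set` x :: s] = [set x] `|` [set` s].
  apply/seteqP; split=> y /=; rewrite inE.
    by case/predU1P => [->|]; [left|right].
  by case=> [->|->]; rewrite ?eqxx ?orbT.
rewrite ge0_integral_setU//; last first.
  by apply/disj_setPS => y [/= -> ys]; rewrite ys in xs.
by rewrite integral_counting1 IH// big_cons.
Qed.

(** The integral is the supremum of the finite sums: if these are bounded,
the sets where f >= 1/(n+1) are finite, and the integral over their increasing
union is the limit of finite sums. *)
Lemma integral_counting_le (f : D -> R) (M : R) : (forall x, 0 <= f x) ->
  (forall s : seq D, uniq s -> \sum_(x <- s) f x <= M) ->
  (\int[cnt]_x (f x)%:E <= M%:E)%E.
Proof.
move=> f0 fM; pose F n := [set x | n.+1%:R^-1 <= f x].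
have f0' x : (0 <= (f x)%:E)%E by rewrite lee_fin.
have finF n : finite_set (F n).
  apply: contrapT => /(infinite_set_fset (Num.truncn (M * n.+1%:R)).+1)[B BF cB].
  have := fM (enum_fset B) (fset_uniq B); apply/negP; rewrite -ltNge.
  apply: (@lt_le_trans _ _ (\sum_(x <- B) n.+1%:R^-1)); last first.
    rewrite big_seq [leRHS]big_seq; apply: ler_sum => x xB; exact: BF.
  rewrite big_const_seq count_predT iter_addr_0 -[ltRHS]mulr_natr mulrC ltr_pdivlMr//.
  by apply: lt_le_trans (truncnS_gt _) _; rewrite ler_nat.
have IF n : (\int[cnt]_(x in F n) (f x)%:E <= M%:E)%E.
  have -> : F n = [set` fset_set (F n)] by rewrite fset_setK.
  rewrite (integral_counting_seq (fset_uniq _) f0') sumEFin lee_fin.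
  exact: fM (fset_uniq _).
have ndF : nondecreasing_seq F.
  move=> m n mn; apply/subsetPset => x; apply: le_trans.
  by rewrite lef_pV2 ?posrE// ler_nat.
have cF := @ge0_nondecreasing_set_cvg_integral _ _ _ F (EFin \o f) cnt ndF
  (fun=> I) (fun=> measurable_discrete _) (fun _ x _ => f0' x).
rewrite [leLHS](_ : _ = \int[cnt]_(x in \bigcup_i F i) (f x)%:E)%E.
  rewrite -(cvg_lim _ cF)//; apply: lime_le; first exact: cvgP cF.
  exact: nearW.
rewrite [RHS]integral_mkcond; apply: eq_integral => x _.
rewrite patchE; case: ifPn => // /negP xF; congr EFin; apply/eqP.
rewrite eq_le f0 andbT leNgt; apply/negP => fx; apply: xF.
rewrite inE; exists (Num.truncn (f x)^-1) => //=.
by rewrite /F/= -[leRHS]invrK lef_pV2 ?posrE ?invr_gt0// ltW// truncnS_gt.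
Qed.

Section pairing.
Variable f : D -> R.
Hypothesis fi : cnt.-integrable setT (EFin \o f).

Definition l1norm := \int[cnt]_x `|f x|.

Lemma l1normE : (l1norm%:E = \int[cnt]_x `|(f x)%:E|)%E.
Proof.
rewrite fineK//.
by have /integrableP[_ h] := fi; rewrite ge0_fin_numE//; apply: integral_ge0.
Qed.

Lemma integrable_pairing (u : D -> R) (c : R) : (forall x, `|u x| <= c) ->
  cnt.-integrable setT (EFin \o (fun x => f x * u x)).
Proof.
move=> uc; apply: (@le_integrable _ _ _ cnt setT measurableT _
  (EFin \o (fun x => c * f x))) => //=.
  move=> x _; rewrite lee_fin mulrC !normrM ler_wpM2r//.
  by apply: le_trans (uc x) _; exact: ler_norm.
exact: (integrableZl _ _ fi).
Qed.

(** The sum of the series f_x u_x over the possibly uncountable [D]. *)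
Definition pairing (u : D -> R) := \int[cnt]_x (f x * u x).

Lemma pairing_le u c : (forall x, `|u x| <= c) -> `|pairing u| <= l1norm * c.
Proof.
move=> uc; have ui := integrable_pairing uc.
apply: le_trans (le_normr_Rintegral _ ui) _ => //.
have ai : cnt.-integrable setT (EFin \o (fun x => `|f x|)) by exact: integrable_norm.
rewrite /l1norm -RintegralZr//; apply: le_Rintegral => //.
- exact: integrable_norm.
- exact: (integrableZr _ _ ai).
- by move=> x _; rewrite normrM ler_wpM2l.
Qed.

Lemma pairing_single u k : (forall x, x <> k -> u x = 0) -> pairing u = f k * u k.
Proof.
move=> u0; rewrite /pairing /Rintegral.
rewrite [X in fine X](_ : _ = \int[cnt]_(x in [set k]) (f x * u x)%:E)%E.
  by rewrite integral_counting1.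
rewrite [RHS]integral_mkcond; apply: eq_integral => x _; rewrite patchE.
case: ifPn => // /negP xk; rewrite u0 ?mulr0// => E; apply: xk.
by rewrite inE.
Qed.

(** A bounded [u] that agrees with the signs of [f] on a large finite set
nearly norms [f]: off that set the loss is at most twice the tail of [f]. *)
Lemma pairing_norming e : 0 < e -> exists s : seq D, forall u,
  (forall x, `|u x| <= 1) -> (forall x, x \in s -> u x = Num.sg (f x)) ->
  l1norm - e <= pairing u.
Proof.
move=> e0.
have [s us sN] : exists2 s : seq D, uniq s &
    l1norm - e / 2 < \sum_(x <- s) `|f x|.
  apply: contrapT => h.
  have : (\int[cnt]_x `|(f x)%:E| <= (l1norm - e / 2)%:E)%E.
    apply: integral_counting_le => // s us; rewrite leNgt; apply/negP => ?.
    by apply: h; exists s.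
  by rewrite -l1normE lee_fin; lra.
exists s => u u1 us1.
have ai : cnt.-integrable setT (EFin \o (fun x => `|f x|)) by exact: integrable_norm.
have ci : cnt.-integrable setT (EFin \o (fun x => `|f x| * \1_[set` s] x)).
  apply: le_integrable ai => // x _.
  rewrite /= lee_fin normrM normr_id indicE normr_nat.
  by case: (_ \in _); rewrite ?mulr1 ?mulr0.
have ni := integrable_pairing u1.
have : \int[cnt]_x (2 * (`|f x| * \1_[set` s] x) - `|f x|) <= pairing u.
  apply: le_Rintegral => //.
    exact: integrableB (integrableZl _ _ ci) ai.
  move=> x _; rewrite indicE; case: (boolP (x \in [set` s])) => xs.
    rewrite us1; last by rewrite inE in xs.
    by rewrite (mulrC (f x)) -normrEsg mulr1; lra.
  have := u1 x; have := ler_norm (- (f x * u x)); rewrite normrN normrM => h1 h2.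
  have : `|f x| * `|u x| <= `|f x| by rewrite ler_piMr.
  rewrite mulr0; lra.
apply: le_trans; rewrite RintegralB//; last exact: (integrableZl _ _ ci).
rewrite RintegralZl// -/l1norm.
have -> : \int[cnt]_x (`|f x| * \1_[set` s] x) = \sum_(x <- s) `|f x|.
  rewrite /Rintegral [X in fine X](_ : _ = \int[cnt]_(x in [set` s]) `|f x|%:E)%E.
    by rewrite integral_counting_seq// sumEFin.
  rewrite [RHS]integral_mkcond; apply: eq_integral => x _; rewrite patchE indicE.
  by case: ifPn => xs; rewrite ?mulr1 ?mulr0.
lra.
Qed.

End pairing.
End discrete_space.

Section L1_counting.
Local Open Scope quotient_scope.
Context (R : realType) (K : Type) (k0 : K).
Notation D := (discrete_space k0).
Notation cnt := (@counting D R : {measure set D -> \bar R}).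

(** Points have measure 1, so the only null set is empty. *)
Lemma ae_counting (P : set D) : {ae cnt, forall x, P x} -> forall x, P x.
Proof.
move=> [A [_ A0 PA]] x; apply: contrapT => nPx.
have Ax : A x by exact: PA.
have : (cnt [set x] <= cnt A)%E by apply: le_measure; rewrite ?inE// => _ ->.
rewrite A0 [X in (X <= _)%E]/(counting _) /counting asboolT//.
by rewrite fset_set1 cardfs1 lee_fin ler10.
Qed.

Lemma L1_counting_repr (f : LfunType cnt (lexx 1%E)) : repr (\pi_(L1 cnt) f) =1 f.
Proof. by move=> x; exact: (ae_counting (L1_reprK f)). Qed.

Lemma L1_counting_linear a (x y : L1 cnt) i :
  repr (a *: x + y) i = a * repr x i + repr y i.
Proof.
by rewrite -[x in LHS]reprK -[y in LHS]reprK -L1_piZ -L1_piD L1_counting_repr.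
Qed.

Lemma L1_counting_norm (x : L1 cnt) : `|x| = l1norm (repr x).
Proof.
apply: EFin_inj; rewrite l1normE; last exact: Lfun_integrableT.
by rewrite -[x in LHS]reprK L1_normE.
Qed.

End L1_counting.

(** * Duals and isometries *)

(** The target of linear forms is the regular module of [R]; this form of
linearity is stated in [R] itself, where the ring tactics apply. *)
Lemma linear_formP (R : realType) (V : lmodType R) (f : {linear V -> R^o}) a x y :
  f (a *: x + y) = a * f x + f y :> R.
Proof. exact: linearP. Qed.

Section dual_norm.
Context (R : realType) (V : normedModType R).
Implicit Types f : dual_space V.

Lemma dual_ext (f g : dual_space V) : (forall x, f x = g x) -> f = g.
Proof. by move=> fg; apply: val_inj; apply/funext. Qed.

Lemma dual_norm_ub f x : `|f x| <= `|f| * `|x|.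
Proof.
have [->|x0] := eqVneq x 0; first by rewrite linear0 !normr0 mulr0.
have nx : 0 < `|x| by rewrite normr_gt0.
rewrite -ler_pdivrMr// mulrC.
have := @supnorm_ub _ _ _ _ (`|x|^-1 *: x) (dual_supbounded f).
rewrite linearZ normrM normfV normr_id /=; apply.
by rewrite normrZ normfV normr_id mulVf// gt_eqF.
Qed.

Lemma dual_norm_le f M : (forall x, `|x| <= 1 -> f x <= M) -> `|f| <= M.
Proof.
move=> fM; apply: supnorm_le => [|x /= x1].
  by have := fM 0; rewrite normr0 linear0; apply.
rewrite ler_norml lerNl fM// andbT.
by have := fM (- x); rewrite normrN linearN; apply.
Qed.

Lemma dual_norm_approx f e : 0 < e -> exists2 x, `|x| <= 1 & `|f| - e < f x.
Proof.
move=> e0; apply: contrapT => h.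
have : `|f| <= `|f| - e; last by lra.
apply: dual_norm_le => x x1; rewrite leNgt; apply/negP => fx.
by apply: h; exists x.
Qed.

Lemma dual_formP f a x y : f (a *: x + y) = a * f x + f y :> R.
Proof. exact: linear_formP. Qed.

Lemma dual_combE a f g x : (a *: f + g) x = a * f x + g x :> R.
Proof. by []. Qed.

Lemma dual_of (f : V -> R) (C : R) :
  (forall a x y, f (a *: x + y) = a * f x + f y) ->
  (forall x, `|f x| <= C * `|x|) -> exists F : dual_space V, forall x, F x = f x.
Proof.
move=> lf fC.
pose fl : {linear V -> R^o} :=
  HB.pack (f : V -> R^o) (GRing.isLinear.Build R V R^o _ (f : V -> R^o) lf).
have cf : continuous (fl : V -> R^o).
  by apply: bounded_fun_norm_continuous; exact: (@linear_le_bounded _ _ R^o fl C).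
have Pf : (fl : V -> R^o) \in @functional R V by rewrite inE; split.
by exists (Dual Pf).
Qed.

End dual_norm.

Lemma isometry_sym (R : realType) (U V : normedModType R) (g : {linear V -> U}) :
  (forall x, `|g x| = `|x|) -> (forall y, exists x, g x = y) ->
  isometrically_isomorphic U V.
Proof.
move=> gi /choice[h gh].
have gI : injective g.
  move=> x y gxy; apply/eqP; rewrite -subr_eq0 -normr_eq0 -gi linearB gxy subrr.
  by rewrite normr0.
have hg : cancel g h by move=> x; apply: gI; rewrite gh.
have lh : linear h by move=> a x y; apply: gI; rewrite gh linearP !gh.
pose hl : {linear U -> V} := HB.pack h (GRing.isLinear.Build R U V _ h lh).
exists hl; split=> [|x]; first by exists g.
by rewrite -gi; congr (`|_|); exact: gh.
Qed.

(** * The dual of a twisted sum with c0 under a compatible norm *)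

(** In a twisted sum [W] of c0 and [X], the e_k stand for the unit vectors of
c0 and the w_i for extensions of its coordinates to [W].
[unit_ball] and the two inequalities before it say that the norm is the maximum
of |Q z| and sup_i |w_i z|; [w_fin] is the compatibility of the extended
coordinates with the quotient, on which the isometry rests. *)
Section twisted_dual.
Local Open Scope quotient_scope.
Context (R : realType) (K : Type) (k0 : K) (X W : normedModType R).
Notation D := (discrete_space k0).
Notation cnt := (@counting D R : {measure set D -> \bar R}).
Variables (Q : {linear W -> X}) (w : D -> {linear W -> R^o}) (e : D -> W).
Hypothesis Q_le : forall z, `|Q z| <= `|z|.
Hypothesis w_le : forall i z, `|w i z| <= `|z|.
Hypothesis unit_ball : forall z,
  `|Q z| <= 1 -> (forall i, `|w i z| <= 1) -> `|z| <= 1.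
Hypothesis Q_surj : forall x, exists z, Q z = x.
Hypothesis Q_unit : forall k, Q (e k) = 0.
Hypothesis w_unit : forall i k, w i (e k) = (i == k)%:R.
Hypothesis w_fin : forall z, `|Q z| <= 1 -> finite_set [set i | 1 < `|w i z|].
Hypothesis Q_factor : forall phi : dual_space W, (forall k, phi (e k) = 0) ->
  exists f : dual_space X, forall z, phi z = f (Q z).

Definition with_coords (s : seq D) (c : D -> R) z :=
  z + \sum_(k <- s) (c k - w k z) *: e k.

Lemma Q_with_coords s c z : Q (with_coords s c z) = Q z.
Proof.
rewrite linearD linear_sum big1 ?addr0// => k _.
by rewrite linearZ /= Q_unit scaler0.
Qed.

Lemma w_with_coords s c z i : uniq s ->
  w i (with_coords s c z) = (if i \in s then c i else w i z).
Proof.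
move=> us; rewrite linearD linear_sum /=.
have -> : \sum_(k <- s) w i ((c k - w k z) *: e k) =
          \sum_(k <- s) (if k == i then c k - w k z else 0) :> R.
  apply: eq_bigr => k _; transitivity ((c k - w k z) * (i == k)%:R).
    by rewrite -w_unit; exact: linearZ.
  by rewrite eq_sym; case: eqP => _; rewrite ?mulr1 ?mulr0.
case: ifPn => [is_|nis].
  rewrite (bigD1_seq i)//= eqxx big1 ?addr0 => [|k /negPf->//].
  by rewrite addrC subrK.
rewrite big_seq big1 ?addr0// => k ks.
by case: eqP => // ki; rewrite -ki ks in nis.
Qed.

Definition twisted (f : dual_space X) (b : L1 cnt) (z : W) : R :=
  f (Q z) + pairing (repr b) (fun i => w i z).

Let pair_int (b : L1 cnt) z :
  cnt.-integrable setT (EFin \o (fun i => repr b i * (w i z : R))).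
Proof. by apply: integrable_pairing (w_le ^~ z) => //; exact: Lfun_integrableT. Qed.

Lemma twisted_linear f b a x y :
  twisted f b (a *: x + y) = a * twisted f b x + twisted f b y.
Proof.
rewrite /twisted /pairing.
rewrite (@eq_Rintegral _ _ _ _ _
    (fun i => a * (repr b i * w i x) + repr b i * w i y)); last first.
  by move=> i _ /=; rewrite linear_formP; ring.
rewrite RintegralD//; last exact: (integrableZl _ _ (pair_int b x)).
by rewrite RintegralZl// (linearP Q) dual_formP; ring.
Qed.

Lemma twisted_bounded f b z : `|twisted f b z| <= (`|f| + `|b|) * `|z|.
Proof.
apply: le_trans (ler_normD _ _) _; rewrite mulrDl lerD//.
  by apply: le_trans (dual_norm_ub _ _) _; rewrite ler_wpM2l.
rewrite L1_counting_norm; apply: pairing_le => //; exact: Lfun_integrableT.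
Qed.

(** For the lower bound, start from a lift [z0] of a vector of the unit ball of
[X] that nearly norms [f].  By [w_fin] only finitely many of its coordinates
exceed 1; changing those, and those on which most of the mass of [b] sits, into
the signs of [b] yields a vector of the unit ball of [W] with the same image in
[X]. *)
Lemma twisted_norm (phi : dual_space W) f b :
  (forall z, phi z = twisted f b z) -> `|phi| = `|f| + `|b|.
Proof.
move=> phiE; apply/eqP; rewrite eq_le; apply/andP; split.
  apply: dual_norm_le => z z1; rewrite phiE.
  apply: le_trans (ler_norm _) _; apply: le_trans (twisted_bounded _ _ _) _.
  by rewrite ler_piMr// addr_ge0.
apply/ler_addgt0Pr => eps eps0.
have h0 : 0 < eps / 2 by rewrite divr_gt0.
have [x x1 fx] := dual_norm_approx f h0.
have [s sP] := pairing_norming (Lfun_integrableT (repr b)) h0.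
have [z0 z0x] := Q_surj x.
have /finite_seqP[t tE] : finite_set [set i | 1 < `|w i z0|].
  by apply: w_fin; rewrite z0x.
pose z := with_coords (undup (s ++ t)) (fun i => Num.sg (repr b i)) z0.
have Qz : Q z = Q z0 by exact: Q_with_coords.
have wz i := w_with_coords (fun i => Num.sg (repr b i)) z0 i (undup_uniq (s ++ t)).
rewrite -/z in wz.
have wz1 i : `|w i z| <= 1.
  rewrite wz; case: ifPn => [_|].
    by rewrite [leLHS]normr_sg; case: (_ != 0).
  rewrite mem_undup mem_cat negb_or => /andP[_ nt]; rewrite leNgt; apply/negP => h.
  have : [set i | 1 < `|w i z0|] i by [].
  by rewrite tE /= (negPf nt).
have z1 : `|z| <= 1 by apply: unit_ball => //; rewrite Qz z0x.
have bz : `|b| - eps / 2 <= pairing (repr b) (fun i => w i z).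
  rewrite L1_counting_norm; apply: sP => // i si.
  by rewrite wz mem_undup mem_cat si.
have pz : phi z <= `|phi|.
  apply: le_trans (ler_norm _) _; apply: le_trans (dual_norm_ub _ _) _.
  by rewrite ler_piMr.
have : phi z = f x + pairing (repr b) (fun i => w i z) :> R.
  by rewrite phiE /twisted Qz z0x.
move: (phi z : R) (f x : R) pz fx bz => u v; lra.
Qed.

(** Evaluate [phi] at the sum over [s] of the e_k with the signs of phi (e_k);
it lies in the unit ball. *)
Lemma l1_coefs (phi : dual_space W) (s : seq D) : uniq s ->
  \sum_(k <- s) `|phi (e k)| <= `|phi|.
Proof.
move=> us.
pose z := with_coords s (fun i => Num.sg (phi (e i) : R)) 0.
have z1 : `|z| <= 1.
  apply: unit_ball => [|i]; first by rewrite Q_with_coords linear0 normr0 ler01.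
  rewrite w_with_coords//; case: ifPn => _; last by rewrite linear0 normr0 ler01.
  by rewrite [leLHS]normr_sg; case: (_ != 0).
have <- : phi z = \sum_(k <- s) `|phi (e k)| :> R.
  rewrite linearD linear_sum linear0 add0r; apply: eq_bigr => k _.
  by rewrite linear0 subr0 linearZ [RHS]normrEsg.
apply: le_trans (ler_norm _) _; apply: le_trans (dual_norm_ub _ _) _.
by rewrite ler_piMr.
Qed.

(** The coefficients are forced, b_k = phi (e_k); what remains of [phi] vanishes
on all e_k and comes from [X] by [Q_factor]. *)
Lemma twisted_surj (phi : dual_space W) :
  exists f b, forall z, phi z = twisted f b z.
Proof.
pose a (i : D) : R := phi (e i).
have ai : cnt.-integrable setT (EFin \o a).
  apply/integrableP; split => //.
  have : (\int[cnt]_x `|a x|%:E <= `|phi|%:E)%E.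
    by apply: integral_counting_le => // s; exact: l1_coefs.
  by move=> /le_lt_trans; apply; rewrite ltry.
have [A AE] := integrable_Lfun ai.
pose b : L1 cnt := \pi_(L1 cnt) A.
have bE i : repr b i = phi (e i) by rewrite L1_counting_repr AE.
have [tau tauE] := dual_of (twisted_linear 0 b) (twisted_bounded 0 b).
have [k|f fE] := Q_factor (phi := phi - tau).
  rewrite [LHS]/(phi (e k) - tau (e k)) tauE /twisted Q_unit linear0 add0r.
  rewrite (@pairing_single _ _ _ _ _ k) => [|i /eqP ik]; last first.
    by rewrite w_unit (negPf ik).
  by rewrite bE w_unit eqxx mulr1; exact: subrr.
exists f, b => z; rewrite /twisted -fE [X in _ = X + _]/(phi z - tau z) tauE.
by rewrite /twisted [(0 : dual_space X) _]/(0 : R) add0r subrK.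
Qed.

Theorem twisted_dual d (T : measurableType d) (mu : {measure set T -> \bar R}) :
  isometrically_isomorphic (dual_space X) (L1 mu) ->
  isometrically_isomorphic (dual_space W) (L1 (sum_measure mu cnt)).
Proof.
move=> [Psi [[inv PsiK invK] Psi_iso]].
have [P1 [P2 [P_norm P_surj]]] := L1_sum mu cnt.
have /choice[g gE] : forall x : L1 (sum_measure mu cnt), exists phi : dual_space W,
    forall z, phi z = twisted (inv (P1 x)) (P2 x) z.
  by move=> x; exact: dual_of (twisted_linear _ _) (twisted_bounded _ _).
have invP a x y : inv (a *: x + y) = a *: inv x + inv y.
  by apply: (can_inj PsiK); rewrite linearP !invK.
have lg : linear g.
  move=> a x y; apply: dual_ext => z; rewrite gE.
  rewrite dual_combE !gE /twisted !linearP invP.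
  rewrite dual_combE.
  rewrite /pairing (@eq_Rintegral _ _ _ _ _
      (fun i => a * (repr (P2 x) i * w i z) + repr (P2 y) i * w i z)); last first.
    by move=> i _; rewrite L1_counting_linear; ring.
  rewrite RintegralD//; last exact: (integrableZl _ _ (pair_int _ z)).
  by rewrite RintegralZl//; ring.
pose gl : {linear L1 (sum_measure mu cnt) -> dual_space W} :=
  HB.pack g (GRing.isLinear.Build R _ _ _ g lg).
apply: (@isometry_sym _ _ _ gl) => [x|phi].
  by rewrite (twisted_norm (gE x)) P_norm -{2}(invK (P1 x)) Psi_iso.
have [f [b phiE]] := twisted_surj phi.
have [x [x1 x2]] := P_surj (Psi f) b.
by exists x; apply: dual_ext => z; rewrite gE x1 x2 PsiK.
Qed.

End twisted_dual.

(** * The space c0 *)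

Section c0_unit.
Context (R : realType) (I : choiceType).

Let unit_fun (k i : I) : R^o := (i == k)%:R.

Let unit_vanishing k : unit_fun k \in @vanishing R I.
Proof.
rewrite inE => e e0; apply: (sub_finite_set _ (finite_set1 k)) => i /=.
rewrite /unit_fun; case: eqP => // _.
by rewrite [X in `|X|]/(0 : R) normr0 leNgt e0.
Qed.

Definition c0_unit k : c0 R I := C0 (unit_vanishing k).

Lemma c0_unitE k i : c0_unit k i = (i == k)%:R.
Proof. by []. Qed.

Lemma c0_norm_le (y : c0 R I) M : 0 <= M -> (forall i, `|y i| <= M) -> `|y| <= M.
Proof. by move=> M0 yM; apply: supnorm_le. Qed.

Lemma c0_sumE (s : seq I) (F : I -> c0 R I) i :
  (\sum_(k <- s) F k) i = \sum_(k <- s) (F k i : R) :> R.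
Proof.
by elim: s => [|k s IH]; rewrite ?big_nil// !big_cons -IH.
Qed.

Lemma c0_subE (f g : c0 R I) i : (f - g) i = f i - g i :> R.
Proof. by []. Qed.

(** The unit vectors span a dense subspace of c0: cutting [y] down to the
finite set where |y_i| >= d leaves an error of norm at most d. *)
Lemma c0_unit_dense (f : c0 R I -> R) (C : R) :
  (forall a x y, f (a *: x + y) = a * f x + f y) ->
  (forall y, `|f y| <= C * `|y|) ->
  (forall k, f (c0_unit k) = 0) -> forall y, f y = 0.
Proof.
move=> lf fC fu y; apply/eqP; rewrite -normr_le0; apply/ler_addgt0Pl => e e0.
rewrite addr0.
pose d := e / (`|C| + 1).
have C1 : 0 < `|C| + 1 by rewrite ltr_wpDl.
have d0 : 0 < d by rewrite divr_gt0.
have := c0_vanishing y; rewrite inE => /(_ d d0).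
move=> /finite_seqP[s sE].
have f0 : f 0 = 0.
  by apply/eqP; rewrite -normr_le0; have := fC 0; rewrite normr0 mulr0.
pose y' := \sum_(k <- undup s) (y k : R) *: c0_unit k.
have fy' : f y' = 0.
  rewrite /y'; elim: (undup s) => [|k t IH]; first by rewrite big_nil.
  by rewrite big_cons lf fu IH mulr0 addr0.
have y'E i : y' i = (if i \in s then y i else 0) :> R.
  rewrite c0_sumE -(mem_undup s i).
  transitivity (\sum_(k <- undup s) (if k == i then y i : R else 0)).
    apply: eq_bigr => k _; rewrite [LHS]/((y k : R) * (i == k)%:R) eq_sym.
    by case: eqP => [->|_]; [exact: mulr1|exact: mulr0].
  case: ifPn => [is_|nis].
    by rewrite (bigD1_seq i)//= ?undup_uniq// eqxx big1 ?addr0 => [|k /negPf->].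
  rewrite big_seq big1 // => k ks; case: eqP => // ki.
  by rewrite -ki ks in nis.
have yy' : `|y - y'| <= d.
  apply: c0_norm_le => [|i]; first exact: ltW.
  rewrite c0_subE y'E; case: ifPn => [_|nis].
    by rewrite subrr normr0 ltW.
  rewrite subr0 leNgt; apply/negP => h.
  have : [set i | d <= `|y i|] i by exact: ltW.
  by rewrite sE /= (negPf nis).
have -> : f y = f (y - y').
  by have := lf 1 (y - y') y'; rewrite scale1r subrK fy' addr0 mul1r.
apply: le_trans (fC _) _; apply: (@le_trans _ _ (`|C| * `|y - y'|)).
  by rewrite ler_wpM2r// ler_norm.
apply: (@le_trans _ _ ((`|C| + 1) * d)); first by apply: ler_pM; rewrite ?lerDl.
by rewrite /d mulrC divfK// gt_eqF.
Qed.

End c0_unit.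

(** * Renorming a twisted sum with c0 *)

Section equivalent_norm.
Context (R : realType) (Z : completeNormedModType R) (n : Z -> R) (A B : R).
Hypothesis nD : forall x y, n (x + y) <= n x + n y.
Hypothesis nZ : forall a x, n (a *: x) = `|a| * n x.
Hypothesis A0 : 0 < A.
Hypothesis B0 : 0 < B.
Hypothesis n_le : forall x, n x <= A * `|x|.
Hypothesis le_n : forall x, `|x| <= B * n x.

Lemma equivalent_norm : exists N : banach_norm Z, bnorm N = n.
Proof.
have n0 x : n x = 0 -> x = 0.
  by move=> nx; apply/eqP; rewrite -normr_le0; have := le_n x; rewrite nx mulr0.
have nC (F : set_system Z) : ProperFilter F ->
    (forall e, 0 < e -> exists x, F [set y | n (x - y) < e]) ->
    exists l, forall e, 0 < e -> F [set y | n (l - y) < e].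
  move=> FF Fc; have : cvg F.
    apply: cauchy_cvg; apply: cauchy_exP => e e0.
    have [x Fx] := Fc _ (divr_gt0 e0 B0); exists x; apply: filterS Fx => y /=.
    rewrite ltr_pdivlMr// mulrC -ball_normE; exact: le_lt_trans.
  move=> /cvg_ex[l Fl]; exists l => e e0.
  have /cvgrPdist_lt/(_ _ (divr_gt0 e0 A0)) := Fl; apply: filterS => y.
  by rewrite ltr_pdivlMr// mulrC; exact: le_lt_trans.
by exists (BanachNorm nD nZ n0 nC).
Qed.

Lemma equivalent_norm_isomorphic (N : banach_norm Z) : bnorm N = n ->
  isomorphic Z (normed_by N).
Proof.
move=> NE; pose f : Z -> normed_by N := id; pose g : normed_by N -> Z := id.
pose fl : {linear Z -> normed_by N} :=
  HB.pack f (GRing.isLinear.Build R Z (normed_by N) _ f (fun a x y => erefl)).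
pose gl : {linear normed_by N -> Z} :=
  HB.pack g (GRing.isLinear.Build R (normed_by N) Z _ g (fun a x y => erefl)).
exists fl, gl; split=> //; apply: bounded_fun_norm_continuous.
- by apply: (@linear_le_bounded _ _ _ fl A) => x; rewrite normed_byE NE.
- by apply: (@linear_le_bounded _ _ _ gl B) => x; rewrite normed_byE NE.
Qed.

End equivalent_norm.

Section c0_extension.
Context (R : realType) (I : choiceType) (X Z : completeNormedModType R).
Variables (j : {linear c0 R I -> Z}) (q : {linear Z -> X}).
Hypothesis exact_jq : short_exact_sequence j q.

(** The functional y_i is bounded on the image of [j] by C |j y|; scaling it
by d / C brings its Hahn-Banach extension below d |z|. *)
Lemma coordinate_extension (d : R) : 0 < d ->
  exists c : R, 0 < c /\ exists v : I -> {linear Z -> R^o},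
    (forall i y, v i (j y) = c * (y i : R)) /\ (forall i z, `|v i z| <= d * `|z|).
Proof.
move=> d0; have [C C0 jC] := exact_bounded_below exact_jq.
have dC0 : 0 < d / C by rewrite divr_gt0.
exists (d / C); split => //.
suff /choice[v vP] : forall i, exists v : {linear Z -> R^o},
    (forall y, v (j y) = d / C * (y i : R) :> R) /\ (forall z, `|v z| <= d * `|z|).
  by exists v; split => i; [exact: (vP i).1|exact: (vP i).2].
move=> i.
pose g (y : c0 R I) : R^o := d / C * (y i : R).
have lg : linear g by move=> a x y; rewrite /g [LHS]mulrDr mulrCA.
pose gl : {linear c0 R I -> R^o} := HB.pack g (GRing.isLinear.Build R _ _ _ g lg).
pose p (z : Z) := d * `|z|.
have sp : sublinear p.
  split=> [x y|a x a0]; rewrite /p.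
    by rewrite -mulrDr ler_wpM2l ?ler_normD// ltW.
  by rewrite normrZ gtr0_norm// mulrCA.
have [y|v [vj vp]] := @hahn_banach R _ Z j gl p sp.
  apply: le_trans (ler_norm _) _; rewrite [leLHS]normrM gtr0_norm// /p -mulrA.
  rewrite ler_wpM2l ?(ltW d0)// ler_pdivrMl//.
  by apply: le_trans (c0_le_norm y i) _; exact: jC.
exists v; split=> // z; rewrite ler_norml lerNl vp andbT -linearN.
by apply: le_trans (vp _) _; rewrite /p normrN.
Qed.

(** A bounded functional that kills the unit vectors kills the image of [j] by
density, hence is constant on the fibres of [q]; bounded lifts of the vectors
of [X] give the bound of the induced functional. *)
Lemma factor_through_quotient (phi : Z -> R) (M : R) :
  (forall a x y, phi (a *: x + y) = a * phi x + phi y) ->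
  (forall z, `|phi z| <= M * `|z|) ->
  (forall k, phi (j (c0_unit R k)) = 0) ->
  exists f : dual_space X, forall z, phi z = f (q z).
Proof.
move=> phi_lin phi_le phi0.
have phi_leN z : `|phi z| <= `|M| * `|z|.
  by apply: le_trans (phi_le z) _; rewrite ler_wpM2r// ler_norm.
have [bj _ _ _ _] := exact_jq; have [J J0 jJ] := bounded_fun_normP bj.
have phij y : phi (j y) = 0.
  apply: (@c0_unit_dense R I (fun y => phi (j y)) (`|M| * J)) => //.
    by move=> a x x'; rewrite linearP phi_lin.
  by move=> x; apply: le_trans (phi_leN _) _; rewrite -mulrA ler_wpM2l.
have phiq z z' : q z = q z' -> phi z = phi z'.
  move=> qzz'; have [|y jy] := exact_ker exact_jq (z := z - z').
    by rewrite linearB qzz' subrr.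
  by rewrite -(subrK z' z) -jy -[j y]scale1r phi_lin phij mulr0 add0r.
have [K K0 lift] := bounded_lift exact_jq.
have /choice[h hP] : forall x, exists z, q z = x /\ `|z| <= K * `|x|.
  by move=> x; have [z] := lift x; exists z.
have [qh hK] := all_and2 hP.
have [a x y|x|f fE] := @dual_of R X (fun x => phi (h x)) (`|M| * K).
- by rewrite -phi_lin; apply: phiq; rewrite qh linearP !qh.
- by apply: le_trans (phi_leN _) _; rewrite -mulrA ler_wpM2l.
- by exists f => z; rewrite fE; apply: phiq; rewrite qh.
Qed.

End c0_extension.

Section renorming.
Context (R : realType) (I : choiceType) (X Z : completeNormedModType R).
Variables (j : {linear c0 R I -> Z}) (q : {linear Z -> X}).
Hypothesis exact_jq : short_exact_sequence j q.
Variables (K c : R) (v : I -> {linear Z -> R^o}).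
Hypotheses (K0 : 0 < K) (c_gt0 : 0 < c).
Hypothesis lift : forall x, exists2 z, q z = x & `|z| <= K * `|x|.
Hypothesis vj : forall i y, v i (j y) = c * (y i : R).
Hypothesis v_le : forall i z, `|v i z| <= (2 * K)^-1 * `|z|.

Definition twisted_sum_norm (z : Z) : R :=
  Num.max `|q z| (supnorm setT (fun i => v i z)).

Let vb z : supbounded setT (fun i => v i z).
Proof. by exists ((2 * K)^-1 * `|z|) => _ [i _ <-]. Qed.

Lemma twisted_sum_norm_q z : `|q z| <= twisted_sum_norm z.
Proof. by rewrite le_max lexx. Qed.

Lemma twisted_sum_norm_v i z : `|v i z| <= twisted_sum_norm z.
Proof.
rewrite le_max; apply/orP; right.
exact: (supnorm_ub (f := fun i => v i z) (vb z)).
Qed.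

Lemma twisted_sum_norm_le z r : `|q z| <= r -> (forall i, `|v i z| <= r) ->
  twisted_sum_norm z <= r.
Proof.
move=> qr vr; rewrite ge_max qr; apply: supnorm_le => //.
exact: le_trans qr.
Qed.

Lemma twisted_sum_normD x y :
  twisted_sum_norm (x + y) <= twisted_sum_norm x + twisted_sum_norm y.
Proof.
apply: twisted_sum_norm_le => [|i].
  rewrite linearD; apply: le_trans (ler_normD _ _) _.
  by rewrite lerD// twisted_sum_norm_q.
rewrite linearD; apply: le_trans (ler_normD _ _) _.
by rewrite lerD// twisted_sum_norm_v.
Qed.

Lemma twisted_sum_normZ a x :
  twisted_sum_norm (a *: x) = `|a| * twisted_sum_norm x.
Proof.
rewrite /twisted_sum_norm linearZ normrZ maxr_pMr//; congr Num.max.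
rewrite -(supnormZ a (vb x)); congr supnorm; apply/funext => i.
exact: linearZ.
Qed.

(** Write z = z' + j y with z' the bounded lift of q z: on z' the bound of v_i,
which is 1/(2K), cancels the constant [K] of the lift. *)
Lemma coordinate_le z : exists2 y : c0 R I, `|z - j y| <= K * `|q z| &
  forall i, `|v i z| <= 2^-1 * `|q z| + c * `|y i : R|.
Proof.
have [z' qz' z'K] := lift (q z).
have [|y jy] := exact_ker exact_jq (z := z - z').
  by rewrite linearB qz' subrr.
exists y; first by rewrite jy subKr.
move=> i; have zE : z = z' + j y by rewrite jy addrC subrK.
rewrite {1}zE linearD vj; apply: le_trans (ler_normD _ _) _; apply: lerD.
  apply: le_trans (v_le _ _) _; rewrite invfM -mulrA ler_wpM2l// ler_pdivrMl//.
by rewrite normrM gtr0_norm.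
Qed.

Lemma coordinate_finite z : `|q z| <= 1 -> finite_set [set i | 1 < `|v i z|].
Proof.
move=> qz; have [y _ vy] := coordinate_le z.
have := c0_vanishing y; rewrite inE => /(_ (2 * c)^-1).
rewrite invr_gt0 mulr_gt0// => /(_ isT); apply: sub_finite_set => i /= vi.
rewrite invfM ler_pdivrMr// mulrC.
by have := vy i; lra.
Qed.

Lemma twisted_sum_norm_ub : exists2 A, 0 < A &
  forall z, twisted_sum_norm z <= A * `|z|.
Proof.
have [_ /bounded_fun_normP[C C0 qC] _ _ _] := exact_jq.
have hK : 0 < (2 * K)^-1 by rewrite invr_gt0 mulr_gt0.
exists (C + (2 * K)^-1) => [|z]; first exact: addr_gt0.
apply: twisted_sum_norm_le => [|i].
  by apply: le_trans (qC z) _; rewrite ler_wpM2r// lerDl ltW.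
by apply: le_trans (v_le i z) _; rewrite ler_wpM2r// lerDr ltW.
Qed.

(** The part j y of z is controlled by its coordinates, and these by the v_i:
c |y_i| <= |v_i z| + |v_i (z - j y)| <= 2 |z|'. *)
Lemma twisted_sum_norm_lb : exists2 B, 0 < B &
  forall z, `|z| <= B * twisted_sum_norm z.
Proof.
have [/bounded_fun_normP[J J0 jJ] _ _ _ _] := exact_jq.
exists (K + J * (2 / c)) => [|z]; first by rewrite !(addr_gt0, mulr_gt0, invr_gt0).
have [y zy _] := coordinate_le z.
have qN := twisted_sum_norm_q z; have N0 := le_trans (normr_ge0 _) qN.
have yN : `|y| <= 2 / c * twisted_sum_norm z.
  apply: c0_norm_le => [|i]; first by rewrite mulr_ge0// divr_ge0// ltW.
  rewrite mulrAC ler_pdivlMr// mulrC.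
  have -> : c * `|y i| = `|v i z - v i (z - j y)| :> R.
    by rewrite -[in RHS]linearB subKr vj normrM gtr0_norm.
  apply: le_trans (ler_normB _ _) _.
  have h1 := twisted_sum_norm_v i z.
  have h2 : `|v i (z - j y)| <= 2^-1 * `|q z|.
    apply: le_trans (v_le _ _) _.
    by rewrite invfM -mulrA ler_wpM2l// ler_pdivrMl.
  lra.
rewrite -{1}(subrK (j y) z) mulrDl; apply: le_trans (ler_normD _ _) _.
apply: lerD; first by apply: le_trans zy _; rewrite ler_wpM2l// ltW.
by apply: le_trans (jJ y) _; rewrite -mulrA ler_wpM2l// ltW.
Qed.

End renorming.

Theorem theorem5p1 (R : realType) (kappa : Type)
    (kappa_infinite : infinite_set [set: kappa])
    (X Z : completeNormedModType R)
    (j : {linear c0 R kappa -> Z}) (q : {linear Z -> X})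
    (X_lindenstrauss : lindenstrauss X)
    (exact_jq : short_exact_sequence j q) :
  exists W : completeNormedModType R, lindenstrauss W /\ isomorphic Z W.
Proof.
have [k0 _] : [set: kappa] !=set0 by exact: infinite_setN0.
pose D := discrete_space k0.
pose jD : {linear c0 R D -> Z} := j.
have exD : short_exact_sequence jD q := exact_jq.
have [K K0 lift] := bounded_lift exD.
have [|c [c_gt0 [v [vj v_le]]]] := coordinate_extension exD (d := (2 * K)^-1).
  by rewrite invr_gt0 mulr_gt0.
have [A A0 nA] := twisted_sum_norm_ub exD K0 v_le.
have [B B0 nB] := twisted_sum_norm_lb exD K0 c_gt0 lift vj v_le.
have nD := twisted_sum_normD q v_le.
have nZ := twisted_sum_normZ q v_le.
have [N NE] := equivalent_norm nD nZ A0 B0 nA nB.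
exists (normed_by N : completeNormedModType R); split; last first.
  exact: (@equivalent_norm_isomorphic _ _ _ _ _ nA nB N NE).
have [d [T [mu dualX]]] := X_lindenstrauss.
exists (measure_prod_display (d, default_measure_display)), (sum_space T D).
exists (sum_measure mu (@counting D R : {measure set D -> \bar R})).
pose Qf : normed_by N -> X := q.
pose Q : {linear normed_by N -> X} :=
  HB.pack Qf (GRing.isLinear.Build R (normed_by N) X _ Qf
    (fun a x y => linearP q a x y)).
pose wf (i : D) : normed_by N -> R^o := v i.
pose w (i : D) : {linear normed_by N -> R^o} :=
  HB.pack (wf i) (GRing.isLinear.Build R (normed_by N) R^o _ (wf i)
    (fun a x y => linearP (v i) a x y)).
(* the factor c^-1 makes the w i biorthogonal to the e k *)
pose e (k : D) : normed_by N := c^-1 *: jD (c0_unit R k).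
apply: (@twisted_dual R kappa k0 X (normed_by N) Q w e) dualX.
- by move=> z; rewrite normed_byE NE; exact: twisted_sum_norm_q.
- by move=> i z; rewrite normed_byE NE; exact: (twisted_sum_norm_v q v_le).
- move=> z qz vz; rewrite normed_byE NE; exact: twisted_sum_norm_le qz vz.
- by move=> x; have [z qz _] := lift x; exists z.
- move=> k; suff : q (c^-1 *: jD (c0_unit R k)) = 0 by [].
  by rewrite linearZ /= (exact_comp0 exD) scaler0.
- move=> i k.
  suff : v i (c^-1 *: jD (c0_unit R k)) = (i == k)%:R :> R by [].
  rewrite linearZ /= vj c0_unitE.
  by rewrite [LHS]mulrA mulVf ?mul1r// gt_eqF.
- move=> z qz; have fin := coordinate_finite exD K0 c_gt0 lift vj v_le.
  exact (fin z qz).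
- move=> phi phi0.
  have phi_le z : `|phi z| <= `|phi| * A * `|z : Z|.
    rewrite -mulrA; apply: le_trans (dual_norm_ub _ _) _.
    by rewrite ler_wpM2l// normed_byE NE.
  apply: (@factor_through_quotient R D X Z jD q exD phi (`|phi| * A)) => //.
  + by move=> a x y; exact: (dual_formP phi).
  + move=> k; have := phi0 k; rewrite linearZ /= => /eqP.
    by rewrite mulf_eq0 invr_eq0 gt_eqF//= => /eqP.
Qed.
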